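(* Let $(K,v)$ be a henselian valued field with $v$ non-trivial, and let $a\in K^{\mathrm{sep}}\setminus K$. Assume that $a$ is pure over $K$ and that $(K(a)|K,v)$ is not a tame extension. Set $L:=K(a)\cap K^r$. Then $$\#S_K(a)\leq \begin{cases} v_p(\deg_L(a))+1 & \text{if } \max v(a-K) \text{ exists and } \max v(a-K)\in S_K(a),\\ v_p(\deg_L(a)) & \text{otherwise,}\end{cases}$$ where $v_p$ denotes the $p$-adic valuation and $p$ is the characteristic exponent.
   Context: $\overline{K}$ is a fixed algebraic closure of $K$, $K^{\mathrm{sep}}\subseteq\overline K$ the separable-algebraic closure; the unique extension of $v$ to $\overline K$ is again denoted $v$. $vF$ and $Fv$ denote the value group and residue field of a field $F$ with $K\subseteq F\subseteq\overline K$, and $\deg_F(b)=[F(b):F]$. The characteristic exponent $p$ is $1$ if $\operatorname{char} Kv=0$ and $p=\operatorname{char}Kv$ otherwise. $S_K(a) := \{ v(a-a^\prime) \mid a^\prime\neq a \text{ is a } K\text{-conjugate of } a\}$, and $v(a-K):=\{v(a-z)\mid z\in K\}$. Defect: for a finite extension $(E|K,v)$, $[E:K]=(vE:vK)[Ev:Kv]\,d(E|K,v)$, where the defect $d(E|K,v)$ is a power of $p$. Tame: an algebraic extension $(E|K,v)$ is tame if every finite subextension $(E'|K,v)$ satisfies: $(vE':vK)$ is coprime to $p$, $E'v|Kv$ is separable, and $d(E'|K,v)=1$. $K^r$ (absolute ramification field) is the fixed field in $K^{\mathrm{sep}}$ of $G^r=\{\sigma\in\mathrm{Gal}(\overline K|K)\mid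 v(\sigma x-x)>vx \text{ for all } x\in K^{\mathrm{sep}}\setminus\{0\}\}$. Okutsu sequences and purity: for a positive integer $d<\deg_K(a)$ put $D_d:=\{v(z-a)\mid z\in\overline K,\ \deg_K(z)=d\}$. An Okutsu sequence of $a$ over $K$ is a finite sequence $A_0=\{a\},A_1,\dots,A_n$ of subsets of $\overline K$, all elements of $A_i$ having the same degree $d_i$ over $K$, such that: (OS1) $\deg_K(a)=d_0>d_1>\dots>d_n=1$; (OS2) for all $i\geq1$ and $z\in\overline K$ with $\deg_K(z)<d_{i-1}$ there is $z_i\in A_i$ with $v(a-z_i)\geq v(a-z)$; (OS3) $v(a-z_{i-1})>v(a-z_i)$ for all $i\ge 1$, $z_i\in A_i$, $z_{i-1}\in A_{i-1}$; (OS4) for $i\geq 1$, $\#A_i=1$ if and only if $\max D_{d_i}$ exists, and then $A_i=\{a_i\}$ with $v(a-a_i)=\max D_{d_i}=\max\{v(a-z)\mid \deg_K(z)<d_{i-1}\}$; (OS5) if $\max D_{d_i}$ does not exist, then $A_i=\{z_\nu\}_{\nu<\lambda}$ with $\lambda$ a limit ordinal and $v(a-z_\mu)>v(a-z_\nu)$ for all $\nu<\mu<\lambda$. Every $a\in\overline K\setminus K$ admits an Okutsu sequence, and all its Okutsu sequences have the same length $n$, called the depth $\ell(a)=\ell_K(a)$ of $a$ over $K$. The element $a$ is pure over $K$ if $\ell_K(a)=1$. *)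

(* Defs.v *)
From HB Require Import structures.
From mathcomp Require Import all_boot all_order all_algebra all_field.
From mathcomp Require Import ring_quotient.
From mathcomp Require Import boolp classical_sets functions cardinality wochoice.

Set Implicit Arguments.
Unset Strict Implicit.
Unset Printing Implicit Defensive.

Import Order.TTheory GRing.Theory.

Local Open Scope quotient_scope.
Local Open Scope classical_set_scope.
Local Open Scope ring_scope.

HB.mixin Record isOrderedZmodule G of Num.POrderedZmodule G := {
  ozm_total : total (<=%R : rel G);
  ozm_leD : forall z x y : G, x <= y -> x + z <= y + z }.

#[short(type="orderedZmodType")]
HB.structure Definition OrderedZmodule :=
  { G of isOrderedZmodule G & Num.POrderedZmodule G }.

Variant with_top (G : Type) := Fin of G | Infty.
Arguments Infty {G}.

Section WithTop.
Variable G : orderedZmodType.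
Implicit Types x y z : with_top G.

Definition option_of_top x := if x is Fin g then Some g else None.
Definition top_of_option (o : option G) :=
  if o is Some g then Fin g else Infty.

Fact option_of_topK : cancel option_of_top top_of_option.
Proof. by case. Qed.

HB.instance Definition _ := Choice.copy (with_top G) (can_type option_of_topK).

Definition addt x y :=
  match x, y with Fin g, Fin h => Fin (g + h) | _, _ => Infty end.

Fact addtA : associative addt.
Proof. by move=> [g|] [h|] [k|] //=; rewrite addrA. Qed.
Fact addtC : commutative addt.
Proof. by move=> [g|] [h|] //=; rewrite addrC. Qed.
Fact add0t : left_id (Fin 0) addt.
Proof. by move=> [g|] //=; rewrite add0r. Qed.

HB.instance Definition _ :=
  GRing.isNmodule.Build (with_top G) addtA addtC add0t.

Definition let_top x y :=
  match x, y with
  | _, Infty => true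
  | Fin g, Fin h => g <= h
  | Infty, Fin _ => false
  end.

Fact let_top_refl : reflexive let_top. Proof. by case=> [g|] /=. Qed.
Fact let_top_anti : antisymmetric let_top.
Proof. by move=> [g|] [h|] //= /le_anti ->. Qed.
Fact let_top_trans : transitive let_top.
Proof. by move=> [g|] [h|] [k|] //=; exact: le_trans. Qed.

HB.instance Definition _ := Order.Le_isPOrder.Build ring_display (with_top G)
  let_top_refl let_top_anti let_top_trans.

Fact let_top_total : total (<=%O : rel (with_top G)).
Proof. by move=> [g|] [h|] //=; exact: ozm_total. Qed.

HB.instance Definition _ :=
  Order.POrder_isTotal.Build ring_display (with_top G) let_top_total.

End WithTop.

Record valuation (F : fieldType) (G : orderedZmodType) := Valuation {
  val_fun :> F -> with_top G;
  val_inftyP : forall x, val_fun x = Infty <-> x = 0;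
  valM : forall x y, val_fun (x * y) = val_fun x + val_fun y;
  valD : forall x y, Order.min (val_fun x) (val_fun y) <= val_fun (x + y) }.

Section ResidueField.
Variables (F : fieldType) (G : orderedZmodType) (v : valuation F G).

Fact val1 : v 1 = Fin 0.
Proof.
have := valM v 1 1; rewrite mulr1; case E: (v 1) => [g|].
  by case=> /eqP; rewrite -subr_eq0 opprD addrA subrr sub0r oppr_eq0 => /eqP->.
by move/val_inftyP/eqP: E; rewrite oner_eq0.
Qed.

Fact valN1 : v (-1) = Fin 0.
Proof.
have := valM v (-1) (-1); rewrite mulrNN mulr1 val1.
case: (v (-1)) => [g|] // [E]; congr Fin.
by case/orP: (ozm_total 0 g) => g0; apply: le_anti; rewrite g0 ?andbT /=;
  have := ozm_leD g _ _ g0; rewrite -E add0r.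
Qed.

Fact valN x : v (- x) = v x.
Proof. by rewrite -mulN1r valM valN1 add0r. Qed.

Fact addt_ge0 (x y : with_top G) : Fin 0 <= x -> Fin 0 <= y -> Fin 0 <= x + y.
Proof.
case: x y => [g|] [h|] // g0 h0.
have /(le_trans _) := ozm_leD h _ _ g0; apply; by rewrite add0r.
Qed.

Definition valuation_ring : {pred F} := fun x => Fin 0 <= v x.

Fact valuation_ring_closed : subring_closed valuation_ring.
Proof.
split=> [|x y x0 y0|x y x0 y0]; rewrite /valuation_ring unfold_in.
- by rewrite val1.
- by apply: le_trans (valD v _ _); rewrite valN le_min; apply/andP.
- by rewrite valM addt_ge0.
Qed.

HB.instance Definition _ :=
  GRing.isSubringClosed.Build F valuation_ring valuation_ring_closed.

Record valring := Valring { vr_val : F; _ : vr_val \in valuation_ring }.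

HB.instance Definition _ := [isSub for vr_val].
HB.instance Definition _ := [Choice of valring by <:].
HB.instance Definition _ := [SubChoice_isSubComNzRing of valring by <:].

Definition maximal_ideal : {pred valring} := fun x => Fin 0 < v (val x).

Fact addt_gt0 (x y : with_top G) : Fin 0 <= x -> Fin 0 < y -> Fin 0 < x + y.
Proof.
move=> x0 y0; rewrite lt_neqAle addt_ge0 ?(ltW y0) // andbT.
apply/eqP => E; have := y0; rewrite ltNge => /negP; apply.
case: x y x0 {y0} E => [g|] [h|] // g0 [->].
by have := ozm_leD h _ _ g0; rewrite add0r.
Qed.

Fact maximal_ideal_closed : idealr_closed maximal_ideal.
Proof.
split=> [||x y z y0 z0]; rewrite /maximal_ideal unfold_in /=.
- by case: (val_inftyP v 0) => _ ->.
- by rewrite val1 ltxx.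
- apply: lt_le_trans (valD v _ _); rewrite lt_min; apply/andP; split=> //.
  by rewrite valM addt_gt0 //; exact: (valP x).
Qed.

HB.instance Definition _ :=
  isIdealr.Build valring maximal_ideal maximal_ideal_closed.

Definition residue_field := {ideal_quot maximal_ideal}.

HB.instance Definition _ := GRing.ComNzRing.on residue_field.

Definition residue (x : valring) : residue_field := \pi_(residue_field) x.

Fact residue_eq0 x : (residue x == 0) = (x \in maximal_ideal).
Proof.
by rewrite /residue -[0 in LHS](rmorph0 \pi_(residue_field)) -Quotient.idealrBE subr0.
Qed.

Fact residue_field_inv (x : residue_field) : x != 0 -> exists y, y * x = 1.
Proof.
rewrite -[x]reprK -/(residue _); move: (repr x) => {}x.
rewrite residue_eq0 => xM; have x0 : v (val x) = Fin 0.
  by apply/eqP; rewrite eq_le (valP x : Fin 0 <= _) andbT leNgt.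
have xn0 : val x != 0 by apply/eqP => /(val_inftyP v); rewrite x0.
have xV : (val x)^-1 \in valuation_ring.
  have := valM v (val x) (val x)^-1.
  by rewrite divff // val1 x0 add0r unfold_in => <-.
exists (residue (Valring xV)); rewrite /residue -rmorphM -(rmorph1 \pi_(residue_field)).
by congr (\pi _); apply: val_inj; rewrite /= mulVf.
Qed.

Definition inv_residue (x : residue_field) : residue_field :=
  xget 0 [set y | y * x = 1].

Fact mulVf_residue x : x != 0 -> inv_residue x * x = 1.
Proof.
by move=> /residue_field_inv[y yx]; rewrite /inv_residue; case: xgetP => [z _ //|/(_ y)].
Qed.

Fact inv_residue0 : inv_residue 0 = 0.
Proof.
rewrite /inv_residue; case: xgetP => // y _ /esym/eqP.
by rewrite mulr0 oner_eq0.
Qed.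

HB.instance Definition _ :=
  GRing.ComNzRing_isField.Build residue_field mulVf_residue inv_residue0.

End ResidueField.

Section FieldExtensions.
Variable F : fieldType.
Implicit Types (K E : set F) (x y : F).

Definition subfield K := divring_closed [in K].

Definition adjoin K x : set F := smallest subfield (K `|` [set x]).

(* [e] is a basis of [E] as a [K]-vector space *)
Definition is_basis K E n (e : 'rV[F]_n) :=
  (forall i, E (e 0 i)) /\
  forall x, E x -> exists! c : 'rV[F]_n,
    (forall i, K (c 0 i)) /\ x = \sum_i c 0 i * e 0 i.

Definition finite_ext K E := exists n (e : 'rV[F]_n), is_basis K E e.

(* [E : K], with the junk value 0 when E|K is not finite *)
Definition ext_degree K E : nat :=
  xget 0%N [set n | exists e : 'rV[F]_n, is_basis K E e].

Definition degree K x : nat := ext_degree K (adjoin K x).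

Definition is_min_poly K x (p : {poly F}) :=
  [/\ p \is monic, p \is a polyOver [in K], root p x &
      forall q, q \is a polyOver [in K] -> root q x -> p %| q].

Definition algebraic_elt K x :=
  exists p, [/\ p != 0, p \is a polyOver [in K] & root p x].

Definition separable_elt K x :=
  exists2 p, is_min_poly K x p & separable_poly p.

Definition separable_ext K E := forall x, E x -> separable_elt K x.

Definition char_exponent : nat := xget 1%N [set p | p \in [pchar F]].

End FieldExtensions.

Section Closure.
Variables (Kbar : closedFieldType) (K : set Kbar).

(* [Kbar] being algebraically closed, this makes it an algebraic closure of the
   subfield [K] *)
Definition algebraic_closure_of := subfield K /\ forall x, algebraic_elt K x.

Definition sep_closure : set Kbar := [set x | separable_elt K x].

Definition galois_group : set {rmorphism Kbar -> Kbar} :=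
  [set s : {rmorphism Kbar -> Kbar} | bijective s /\ forall x, K x -> s x = x].

Definition conjugates (a : Kbar) : set Kbar :=
  [set b | exists2 s : {rmorphism Kbar -> Kbar}, galois_group s & s a = b].

End Closure.

Definition is_max d (T : porderType d) (A : set T) (m : T) := A m /\ ubound A m.

(* the index (A : B) of subgroups, with the junk value 0 when it is infinite;
   [r] is a complete system of representatives *)
Definition group_index (G : zmodType) (A B : set G) : nat :=
  xget 0%N [set n | exists r : 'I_n -> G, (forall i, A (r i)) /\
                    forall g, A g -> exists! i, B (g - r i)].

Section ValuedFields.
Variables (Kbar : closedFieldType) (G : orderedZmodType).
Variables (v : valuation Kbar G) (K : set Kbar).
Implicit Types (E : set Kbar) (a x z : Kbar).

(* Uniqueness of the extension of [v|K] to [Kbar]. Valuations with values in [G]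
   suffice: the value group of any extension is a divisible hull of [vK], hence
   has a unique order embedding over [vK] into [G], with image [v Kbar]. *)
Definition henselian :=
  forall w : valuation Kbar G, (forall x, K x -> w x = v x) -> w =1 v.

Definition nontrivial_on := exists2 x, K x & x <> 0 /\ v x <> Fin 0.

Definition value_group E : set G := [set g | exists2 x, E x & v x = Fin g].

Definition residue_subfield E : set (residue_field v) :=
  [set residue x | x in [set x : valring v | E (val x)]].

(* the residue field of [Kbar] has the same characteristic as that of [K] *)
Definition resid_char_exponent : nat := char_exponent (residue_field v).

Definition ramification_index E : nat :=
  group_index (value_group E) (value_group K).

Definition inertia_degree E : nat :=
  ext_degree (residue_subfield K) (residue_subfield E).

Definition has_defect E (d : nat) :=
  ext_degree K E = (ramification_index E * inertia_degree E * d)%N.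

Definition tame E :=
  forall E', subfield E' -> K `<=` E' -> E' `<=` E -> finite_ext K E' ->
    [/\ coprime (ramification_index E') resid_char_exponent,
        separable_ext (residue_subfield K) (residue_subfield E') &
        has_defect E' 1].

Definition ramification_group : set {rmorphism Kbar -> Kbar} :=
  [set s : {rmorphism Kbar -> Kbar} | galois_group K s /\
    forall x, sep_closure K x -> x <> 0 -> v x < v (s x - x)].

Definition ramification_field : set Kbar :=
  [set x | sep_closure K x /\
    forall s : {rmorphism Kbar -> Kbar}, ramification_group s -> s x = x].

Definition conj_distances a : set (with_top G) :=
  [set v (a - b) | b in conjugates K a `\ a].

Definition base_distances a : set (with_top G) := [set v (a - z) | z in K].

Definition degree_distances a (d : nat) : set (with_top G) :=
  [set v (z - a) | z in [set z | degree K z = d]].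

(* [A] is the set of values of a family indexed by a limit ordinal, i.e. by a
   nonempty well-ordered set without last element, along which v(a - _) is
   strictly increasing *)
Definition limit_family a (A : set Kbar) :=
  exists (disp : Order.disp_t) (I : orderType disp) (z : I -> Kbar),
    [/\ well_order (<=%O : rel I), [set: I] !=set0,
        forall i : I, exists j : I, (i < j)%O, A = range z &
        forall i j, (i < j)%O -> v (a - z i) < v (a - z j)].

Record okutsu_sequence a (n : nat) (A : nat -> set Kbar) (d : nat -> nat) :
    Prop := OkutsuSequence {
  okutsu_start : A 0%N = [set a];
  okutsu_degree : forall i, (i <= n)%N -> forall z, A i z -> degree K z = d i;
  okutsu_degree_first : d 0%N = degree K a;
  okutsu_degree_decr : forall i, (i < n)%N -> (d i.+1 < d i)%N;
  okutsu_degree_last : d n = 1%N;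
  okutsu_cofinal : forall i, (i < n)%N ->
    forall z, (degree K z < d i)%N ->
      exists2 z', A i.+1 z' & v (a - z) <= v (a - z');
  okutsu_separated : forall i, (i < n)%N ->
    forall z z', A i z -> A i.+1 z' -> v (a - z') < v (a - z);
  okutsu_singleton : forall i, (i < n)%N ->
    (exists z, A i.+1 = [set z]) <->
    (exists m, is_max (degree_distances a (d i.+1)) m);
  okutsu_max : forall i, (i < n)%N -> forall z, A i.+1 = [set z] ->
    is_max (degree_distances a (d i.+1)) (v (a - z)) /\
    is_max [set v (a - y) | y in [set y | (degree K y < d i)%N]] (v (a - z));
  okutsu_limit : forall i, (i < n)%N ->
    ~ (exists m, is_max (degree_distances a (d i.+1)) m) ->
    limit_family a (A i.+1) }.

(* The length of an Okutsu sequence of [a] does not depend on the sequence. *)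
Definition depth a : nat :=
  xget 0%N [set n | exists A d, okutsu_sequence a n A d].

Definition pure a := depth a = 1%N.

End ValuedFields.

(* Main.v *)
Require Import Defs.
From HB Require Import structures.
From mathcomp Require Import all_boot all_order all_algebra all_field.
From mathcomp Require Import boolp classical_sets functions cardinality.
From mathcomp Require Import zify ring.

(* Every conjugate distance is at least every v(a - k) with k in K, so apart from
   max v(a - K), if it exists, all elements of S_K(a) exceed v(a - K); these are
   to be counted.  Let s be a K-automorphism with v(s a - a) > v(a - K).  By
   purity, the roots r of a polynomial q over K with deg q < deg_K(a) satisfy
   v(a - r) < v(s a - a), hence q(s a) lies in q(a)(1 + M): on K(a), s acts like
   an element of G^r.  A Zorn argument extends such an embedding to a K-automorphism
   t with t x in x(1 + M) for all x, so t is in G^r, fixes L, and t a = s a.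
   Finally let X be the set of roots of the minimal polynomial of a over L.  Balls
   of the same kind in X all have the same size by homogeneity, and for
   g = v(t a - a) the residues of (b - a)/(t a - a), for b in X with
   v(b - a) >= g, form a finite set stable under translation by 1, so that its
   size vanishes in the residue field.  Hence each distance exceeding v(a - K) contributes a
   factor p to the size of X, which is deg_L(a). *)

Set Implicit Arguments.
Unset Strict Implicit.
Unset Printing Implicit Defensive.

Import Order.TTheory GRing.Theory.

Local Open Scope classical_set_scope.
Local Open Scope card_scope.
Local Open Scope ring_scope.

(** * Subrings and polynomials over them *)

Record subring (A : nzRingType) := Subring {
  subring_set :> set A;
  subringP : subring_closed [in subring_set] }.

Definition in_subring (A : nzRingType) (S : subring A) : {pred A} :=
  [in subring_set S].

HB.instance Definition _ (A : nzRingType) (S : subring A) :=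
  GRing.isSubringClosed.Build A (in_subring S) (subringP S).

Lemma in_subringP (A : nzRingType) (S : subring A) x :
  reflect (subring_set S x) (x \in in_subring S).
Proof. by apply: (iffP idP) => [/set_mem|/mem_set]. Qed.

Section PolynomialsOverSubring.
Variables (A : comNzRingType) (S : subring A).
Implicit Types (P f : {poly A}) (w : A).

Definition poly_values w : set A :=
  [set x | exists2 P, P \is a polyOver (in_subring S) & P.[w] = x].

Lemma poly_values_closed w : subring_closed [in poly_values w].
Proof.
split=> [|x y|x y].
- by apply/mem_set; exists 1; [exact: rpred1|exact: hornerC].
- move=> /set_mem[P HP <-] /set_mem[Q HQ <-]; apply/mem_set; exists (P - Q).
    exact: rpredB.
  by rewrite hornerD hornerN.
- move=> /set_mem[P HP <-] /set_mem[Q HQ <-]; apply/mem_set; exists (P * Q).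
    exact: rpredM.
  by rewrite hornerM.
Qed.

Definition adjoin_subring w := Subring (poly_values_closed w).

Lemma sub_poly_values w : S `<=` poly_values w.
Proof.
move=> x Sx; exists x%:P; rewrite ?hornerC // polyOverC; exact/in_subringP.
Qed.

Lemma mem_poly_values w : poly_values w w.
Proof. by exists 'X; rewrite ?hornerX ?polyOverX. Qed.

(** The coefficient ring may have zero divisors, as [F * F] does below; division by [f] still works
    and stays within [S] because [f] is monic. *)
Lemma polyOver_divmod f P : f \is monic -> f \is a polyOver (in_subring S) ->
  P \is a polyOver (in_subring S) ->
  exists Q R, [/\ Q \is a polyOver (in_subring S),
    R \is a polyOver (in_subring S), P = Q * f + R & (size R < size f)%N].
Proof.
move=> fmon fS; have [n] := ubnP (size P); elim: n P => // n IH P ltPn PS.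
have [ltPf|leqfP] := ltnP (size P) (size f).
  by exists 0, P; split; rewrite ?mul0r ?add0r ?rpred0.
have f0 : (0 < size f)%N by rewrite size_poly_gt0 monic_neq0.
have P0 : (0 < size P)%N by rewrite (leq_trans f0).
pose c := lead_coef P *: 'X^(size P - size f).
have cS : c \is a polyOver (in_subring S).
  by rewrite polyOverZ ?polyOverXn // (polyOverP _).
(* [c * f] matches [P] in the top coefficient and both vanish beyond it, so [P - c * f] is shorter
   than [P]. *)
have coefcf j : ((size P).-1 <= j)%N -> (c * f)`_j = P`_j.
  move=> lej; rewrite /c -scalerAl coefZ coefXnM.
  have le1 : (size P - size f <= (size P).-1)%N by rewrite -subn1 leq_sub2l.
  rewrite ltnNge (leq_trans le1 lej) /=.
  case: (eqVneq j (size P).-1) => [->|nej].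
    have -> : ((size P).-1 - (size P - size f) = (size f).-1)%N by lia.
    by have /monicP := fmon; rewrite /lead_coef => ->; rewrite mulr1.
  have ltj : (size P <= j)%N.
    by rewrite -(prednK P0) ltn_neqAle eq_sym nej.
  rewrite [P`_j]nth_default // nth_default ?mulr0 //.
  by rewrite -[X in (X <= _)%N](subKn leqfP) leq_sub2r.
have [||Q [R [QS RS eqP ltR]]] := IH (P - c * f).
- apply: (@leq_ltn_trans (size P).-1); last by rewrite prednK.
  by apply/leq_sizeP => j lej; rewrite coefB coefcf // subrr.
- by rewrite rpredB ?rpredM.
- exists (Q + c), R; split=> //; first exact: rpredD.
  by rewrite mulrDl addrAC -eqP subrK.
Qed.

Lemma poly_values_reduce f w : f \is monic ->
  f \is a polyOver (in_subring S) -> root f w -> forall x, poly_values w x ->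
  exists P, [/\ P \is a polyOver (in_subring S), (size P < size f)%N &
    P.[w] = x].
Proof.
move=> fmon fS /rootP fw x [P PS <-].
have [Q [R [QS RS -> ltR]]] := polyOver_divmod fmon fS PS.
by exists R; split; rewrite // hornerD hornerM fw mulr0 add0r.
Qed.

End PolynomialsOverSubring.

(** * Degrees of algebraic elements *)

Section AlgebraicElements.
Variables (F : fieldType) (K : set F).
Hypotheses (K_field : subfield K) (K_alg : forall x, algebraic_elt K x).
Implicit Types (E : subring F) (x : F).

Definition base_subring : subring F :=
  Subring (GRing.divring_closedBM K_field).

(** An algebraic relation with nonzero constant term [c] reads [x * Q.[x] = - c], which yields the
    inverse; a zero constant term is removed by cancelling [x]. *)
Lemma inverse_poly x : x != 0 ->
  exists2 h, h \is a polyOver (in_subring base_subring) & x * h.[x] = 1.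
Proof.
move=> x0; have [P [P0 PK /rootP]] := K_alg x; move: P0 PK.
elim/poly_ind: P => [|Q c IH]; first by rewrite eqxx.
move=> P0 /(polyOverP (S := in_subring base_subring)) PK Px.
have QK : Q \is a polyOver (in_subring base_subring).
  apply/polyOverP => i; have := PK i.+1.
  by rewrite coefD coefMX coefC addr0.
have cK : c \in in_subring base_subring.
  by have := PK 0%N; rewrite coefD coefMX coefC add0r.
case: (eqVneq c 0) => [c0|c0].
  apply: IH => //.
    by apply: contraNneq P0 => ->; rewrite c0 mul0r add0r.
  move: Px; rewrite c0 hornerD hornerMX hornerC addr0 => /eqP.
  by rewrite mulf_eq0 (negPf x0) orbF => /eqP.
exists (- c^-1 *: Q).
  apply: polyOverZ => //; rewrite rpredN.
  have [_ _ /(_ 1 c)] := K_field; rewrite div1r; apply => //.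
  exact: rpred1 (in_subring base_subring).
rewrite hornerZ mulNr mulrN mulrCA [x * _]mulrC.
move: Px => /eqP; rewrite hornerD hornerMX hornerC addr_eq0 => /eqP ->.
by rewrite mulrN opprK mulVf.
Qed.

(** The inverse of [x] is a polynomial in [x] over [K]; hence every ring between [K] and [F] is a
    field, and bare subrings can stand for intermediate fields. *)
Lemma subring_inv E x : K `<=` E -> subring_set E x -> subring_set E x^-1.
Proof.
move=> KE Ex; have [->|x0] := eqVneq x 0.
  by rewrite invr0; apply/in_subringP/rpred0.
have [h hK hx] := inverse_poly x0.
have -> : x^-1 = h.[x] by rewrite -[h.[x]](mulKf x0) hx mulr1.
apply/in_subringP; apply: rpred_horner; last exact/in_subringP.
by apply: polyOverS hK => y /in_subringP Ky; apply/in_subringP/KE.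
Qed.

Lemma subring_subfield E : K `<=` E -> subfield E.
Proof.
move=> KE; have [E1 EB EM] := subringP E; split=> // x y Ex /set_mem Ey.
by apply: EM => //; apply/mem_set/subring_inv.
Qed.

Lemma adjoinE E x : K `<=` E -> adjoin E x = poly_values E x.
Proof.
move=> KE; apply/seteqP; split=> y.
  apply; split; first exact: (subring_subfield (E := adjoin_subring E x))
    (subset_trans KE (@sub_poly_values _ E x)).
  by move=> z [/sub_poly_values //|->]; exact: mem_poly_values.
move=> [P PE <-] M [Mfield ExM].
pose MS := Subring (GRing.divring_closedBM Mfield).
apply/(@in_subringP _ MS); apply: rpred_horner.
  by apply: polyOverS PE => z /in_subringP Ez; apply/in_subringP/ExM; left.
by apply/in_subringP/ExM; right.
Qed.

(** Minimality is by degree, not by divisibility as in [is_min_poly]; [minimal_dvd] recovers the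
    latter. *)
Definition minimal_over E x (f : {poly F}) :=
  [/\ f \is monic, f \is a polyOver (in_subring E), root f x &
    forall q, q \is a polyOver (in_subring E) -> root q x -> q != 0 ->
      (size f <= size q)%N].

Lemma exists_minimal E x : K `<=` E -> exists f, minimal_over E x f.
Proof.
move=> KE; pose good n := `[< exists q, [/\ q != 0,
  q \is a polyOver (in_subring E), root q x & size q = n] >].
have [n gn] : exists n, good n.
  have [P [P0 PK Px]] := K_alg x; exists (size P); apply/asboolP; exists P.
  split=> //; apply: polyOverS PK => y /set_mem Ky; exact/in_subringP/KE.
case: (ex_minnP (ex_intro _ n gn)) => {gn}n /asboolP[q [q0 qE qx sq]] minn.
exists ((lead_coef q)^-1 *: q); split.
- by rewrite monicE lead_coefZ mulVf // lead_coef_eq0.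
- apply: polyOverZ => //; apply/in_subringP; apply: subring_inv => //.
  by apply/in_subringP/(polyOverP qE).
- by rewrite rootZ // invr_eq0 lead_coef_eq0.
- move=> r rE rx r0; rewrite size_scale ?invr_eq0 ?lead_coef_eq0 // sq.
  by apply: minn; apply/asboolP; exists r.
Qed.

Lemma minimal_eq0 E x f q : minimal_over E x f ->
  q \is a polyOver (in_subring E) -> root q x -> (size q < size f)%N -> q = 0.
Proof.
move=> [_ _ _ fmin] qE qx; rewrite ltnNge; have [->//|q0] := eqVneq q 0.
by rewrite fmin.
Qed.

Lemma minimal_dvd E x f q : minimal_over E x f ->
  q \is a polyOver (in_subring E) -> root q x -> exists k, q = k * f.
Proof.
move=> fm qE qx; have [fmon fE fx _] := fm.
have [k [r [kE rE eqq ltr]]] := polyOver_divmod fmon fE qE; exists k.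
rewrite [q in LHS]eqq (minimal_eq0 fm rE) ?addr0 //.
by move: qx; rewrite eqq !rootE hornerD hornerM (rootP fx) mulr0 add0r.
Qed.

(** Uniqueness of coordinates makes the product [C *m D] of the two transition matrices the
    identity, which bounds its size by the inner dimension [m]. *)
Lemma is_basis_leq E (V : set F) m n (e1 : 'rV[F]_m) (e2 : 'rV[F]_n) :
  is_basis E V e1 -> is_basis E V e2 -> (n <= m)%N.
Proof.
move=> [V1 B1] [V2 B2].
pose Csp j := cid (B1 _ (V2 j)); pose Dsp i := cid (B2 _ (V1 i)).
pose C := \matrix_(j < n, i < m) sval (Csp j) 0 i.
pose D := \matrix_(i < m, j < n) sval (Dsp i) 0 j.
have CE j i : C j i \in in_subring E.
  by rewrite mxE; case: (Csp j) => c /= [[cE _] _]; exact/in_subringP.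
have DE i j : D i j \in in_subring E.
  by rewrite mxE; case: (Dsp i) => c /= [[cE _] _]; exact/in_subringP.
have e2C j : e2 0 j = \sum_i C j i * e1 0 i.
  under eq_bigr do rewrite mxE.
  by case: (Csp j) => c /= [[]].
have e1D i : e1 0 i = \sum_j D i j * e2 0 j.
  under eq_bigr do rewrite mxE.
  by case: (Dsp i) => c /= [[]].
apply: (@mulmx1_min _ _ _ C D); apply/row_matrixP => j.
have [c [_ cuniq]] := B2 _ (V2 j).
have <- : c = row j (C *m D).
  apply: cuniq; split=> [k|].
    by rewrite !mxE; apply/in_subringP; apply: rpred_sum => i _; exact: rpredM.
  rewrite e2C; under [RHS]eq_bigr do rewrite !mxE mulr_suml.
  rewrite exchange_big /=; apply: eq_bigr => i _.
  by rewrite e1D mulr_sumr; apply: eq_bigr => k _; rewrite mulrA.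
apply: cuniq; split=> [k|].
  by rewrite !mxE; apply/in_subringP; rewrite rpred_nat.
rewrite (bigD1 j) //= big1 ?addr0 ?mxE ?eqxx ?mul1r // => k kj.
by rewrite !mxE eq_sym (negPf kj) mul0r.
Qed.

Lemma degree_minimal E x f : K `<=` E -> minimal_over E x f ->
  degree E x = (size f).-1.
Proof.
move=> KE fm; have [fmon fE fx _] := fm.
have f0 : (0 < size f)%N by rewrite size_poly_gt0 monic_neq0.
pose e := \row_(i < (size f).-1) x ^+ i.
have eP : is_basis E (adjoin E x) e.
  rewrite adjoinE //; split=> [i|y].
    exists 'X^i; rewrite ?polyOverXn //; by rewrite hornerXn mxE.
  move=> /(poly_values_reduce fmon fE fx)[P [PE ltP Py]].
  have leP : (size P <= (size f).-1)%N by rewrite -ltnS prednK.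
  exists (\row_(i < (size f).-1) P`_i); split.
    split=> [i|]; first by rewrite mxE; apply/in_subringP/(polyOverP PE).
    rewrite -Py (horner_coef_wide _ leP); apply: eq_bigr => i _.
    by rewrite !mxE.
  move=> c [cE yc]; pose Q := rVpoly c.
  have QE : Q \is a polyOver (in_subring E).
    apply/polyOverP => i; rewrite coef_rVpoly.
    by case: insubP => [j _ _|_]; [apply/in_subringP|rewrite rpred0].
  have leQ : (size Q <= (size f).-1)%N by exact: size_poly.
  have Qy : Q.[x] = y.
    rewrite (horner_coef_wide _ leQ) yc; apply: eq_bigr => i _.
    by rewrite coef_rVpoly_ord !mxE.
  have /eqP : P - Q = 0.
    apply: (minimal_eq0 fm); first by rewrite rpredB.
      by rewrite rootE hornerD hornerN Py Qy subrr.
    rewrite -(prednK f0) ltnS (leq_trans (size_polyD _ _)) // size_polyN.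
    by rewrite geq_max leP.
  rewrite subr_eq0 => /eqP PQ; apply/rowP => i.
  by rewrite !mxE PQ coef_rVpoly_ord.
(* The basis [e] shows that [ext_degree] makes a genuine choice rather than returning its default
   [0]. *)
have [e' e'P] : exists e' : 'rV[F]_(degree E x), is_basis E (adjoin E x) e'.
  pose dims := [set n | exists e' : 'rV[F]_n, is_basis E (adjoin E x) e'].
  by apply: (@xgetI _ 0%N dims (size f).-1); exists e.
apply/eqP; rewrite eqn_leq; apply/andP; split.
  exact: is_basis_leq eP e'P.
exact: is_basis_leq e'P eP.
Qed.

Lemma degree1_mem E x : K `<=` E -> degree E x = 1%N -> subring_set E x.
Proof.
move=> KE; have [f fm] := exists_minimal x KE.
have [fmon fE /rootP fx _] := fm; rewrite (degree_minimal KE fm) => sf.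
have sf2 : size f = 2%N by case: (size f) sf => //= n ->.
move: fx; rewrite horner_coef sf2 big_ord_recr big_ord1 /= expr0 mulr1 expr1.
have /monicP := fmon; rewrite /lead_coef sf2 /= => ->; rewrite mul1r.
move=> /eqP; rewrite addrC addr_eq0 => /eqP ->; apply/in_subringP.
by rewrite rpredN (polyOverP fE).
Qed.

End AlgebraicElements.

(** * Extension of embeddings *)

Lemma maximal_subring (A : nzRingType) (Q : set A) (S : subring A) :
  S `<=` Q -> exists R : subring A, [/\ S `<=` R, R `<=` Q &
    forall R' : subring A, R `<=` R' -> R' `<=` Q -> R' `<=` R].
Proof.
(* The union with [S] makes the empty chain, whose union is [set0], satisfy [good] too. *)
move=> SQ; pose good X := exists2 R : subring A, X `|` S = R & R `<=` Q.
have [C Cgood Ctot|X [[R XR RQ] Xmax]] := @Zorn_bigcup A good; last first.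
  exists R; split=> // [x Sx|R' RR' R'Q x R'x]; first by rewrite -XR; right.
  have SR' : S `<=` R' by move=> y Sy; apply: RR'; rewrite -XR; right.
  have XR' : X `<=` R' by move=> y Xy; apply: RR'; rewrite -XR; left.
  have goodR' : good R' by exists R'; rewrite // setUidl.
  have [R'X|nR'X] := pselect (R' `<=` X).
    by rewrite -XR; left; exact: R'X.
  by case: (Xmax R').
have [[X0 CX0]|C0] := pselect (C !=set0); last first.
  exists S => //; rewrite setUidr // => x [X CX _]; case: C0; by exists X.
have CS x : (\bigcup_(X in C) X `|` S) x <-> exists2 X, C X & (X `|` S) x.
  split=> [[[X CX Xx]|Sx]|[X CX [Xx|Sx]]].
  - by exists X => //; left.
  - by exists X0 => //; right.
  - by left; exists X.
  - by right.
have CS2 x y : (\bigcup_(X in C) X `|` S) x -> (\bigcup_(X in C) X `|` S) y ->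
    exists R : subring A, [/\ R `<=` \bigcup_(X in C) X `|` S,
      subring_set R x & subring_set R y].
  move=> /CS[X CX Xx] /CS[Y CY Yy].
  have key Z : C Z -> (Z `|` S) x -> (Z `|` S) y -> exists R : subring A,
      [/\ R `<=` \bigcup_(X in C) X `|` S, subring_set R x & subring_set R y].
    move=> CZ Zx Zy; have [R ZR _] := Cgood _ CZ.
    by exists R; rewrite -ZR; split=> // z Zz; apply/CS; exists Z.
  by have [XY|YX] := Ctot X Y CX CY; [apply: (key Y)|apply: (key X)] => //;
    apply: setSU Xx || apply: setSU Yy.
have closed : subring_closed [in \bigcup_(X in C) X `|` S].
  split=> [|x y /set_mem Cx /set_mem Cy|x y /set_mem Cx /set_mem Cy].
  - by apply/mem_set; right; apply/in_subringP/rpred1.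
  - have [R [RC /in_subringP Rx /in_subringP Ry]] := CS2 x y Cx Cy.
    by apply/mem_set/RC/in_subringP/rpredB.
  - have [R [RC /in_subringP Rx /in_subringP Ry]] := CS2 x y Cx Cy.
    by apply/mem_set/RC/in_subringP/rpredM.
exists (Subring closed) => //= x /CS[X CX Xx].
have [R XR RQ] := Cgood _ CX; by apply: RQ; rewrite -XR.
Qed.

Section Extension.
Variables (F : closedFieldType) (K : set F).
Hypothesis K_closure : algebraic_closure_of K.

Let K_field : subfield K := proj1 K_closure.
Let K_alg : forall x, algebraic_elt K x := proj2 K_closure.

(* A partial [K]-endomorphism of [F] is handled through its graph, a subring
   of [F * F]; unions of chains are then unions of sets. *)
Implicit Types (R : subring (F * F)%type) (x y z : F).

(** For an additive subgroup of [F * F], being single-valued can be tested at [0]. *)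
Definition is_graph R :=
  (forall k, K k -> subring_set R (k, k)) /\
  forall y, subring_set R (0, y) -> y = 0.

Lemma graph_fun R x y y' : is_graph R ->
  subring_set R (x, y) -> subring_set R (x, y') -> y = y'.
Proof.
move=> [_ R0] /in_subringP Rxy /in_subringP Rxy'; apply/eqP.
rewrite -subr_eq0; apply/eqP/R0/in_subringP.
by have := rpredB Rxy Rxy'; rewrite /= -[_ - _]/(x - x, y - y') subrr.
Qed.

Definition graph_domain R : set F := [set x | exists y, subring_set R (x, y)].

Lemma graph_domain_closed R : subring_closed [in graph_domain R].
Proof.
split=> [|x x' /set_mem[y /in_subringP Ry] /set_mem[y' /in_subringP Ry']
  |x x' /set_mem[y /in_subringP Ry] /set_mem[y' /in_subringP Ry']];
  apply/mem_set.
- by exists 1; apply/in_subringP; exact: rpred1.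
- by exists (y - y'); apply/in_subringP; exact: rpredB Ry Ry'.
- by exists (y * y'); apply/in_subringP; exact: rpredM Ry Ry'.
Qed.

Definition domain_subring R := Subring (@graph_domain_closed R).

Definition graph_app R x : F := xget 0 [set y | subring_set R (x, y)].

Lemma graph_appP R x : graph_domain R x -> subring_set R (x, graph_app R x).
Proof.
by move=> [y Rxy]; exact: (@xgetI _ 0 [set y | subring_set R (x, y)] y Rxy).
Qed.

Lemma graph_appE R x y : is_graph R -> subring_set R (x, y) ->
  graph_app R x = y.
Proof.
by move=> Rg Rxy; apply: (graph_fun Rg _ Rxy); apply: graph_appP; exists y.
Qed.

(** Pairing [q] with its image gives one polynomial over [R], so that division over [R] treats both
    coordinates at once. *)
Definition lift_poly R (q : {poly F}) : {poly (F * F)} :=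
  map_poly (fun x => (x, graph_app R x)) q.

Lemma graph_app0 R : is_graph R -> graph_app R 0 = 0.
Proof.
move=> Rg; apply: graph_appE => //; apply/in_subringP.
exact: (rpred0 (in_subring R)).
Qed.

Lemma graph_app1 R : is_graph R -> graph_app R 1 = 1.
Proof.
move=> Rg; apply: graph_appE => //; apply/in_subringP.
exact: (rpred1 (in_subring R)).
Qed.

Section Lift.
Variables (R : subring (F * F)%type).
Hypothesis Rg : is_graph R.
Let lift0 : (0, graph_app R 0) = 0 :> F * F.
Proof. by rewrite graph_app0. Qed.
Let lift_inj : injective (fun x => (x, graph_app R x)).
Proof. by move=> x y []. Qed.

Lemma size_lift_poly q : size (lift_poly R q) = size q.
Proof. exact: size_map_inj_poly. Qed.

Lemma lift_poly_monic q : q \is monic -> lift_poly R q \is monic.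
Proof.
move=> /monicP q1; apply/monicP.
by rewrite lead_coef_map_inj // q1 graph_app1.
Qed.

Lemma lift_poly_over q : q \is a polyOver (in_subring (domain_subring R)) ->
  lift_poly R q \is a polyOver (in_subring R).
Proof.
move=> /polyOverP qR; apply/polyOverP => i; rewrite coef_map_id0 //.
by apply/in_subringP/graph_appP/(@in_subringP _ (domain_subring R)).
Qed.

Lemma fst_lift_poly q : map_poly fst (lift_poly R q) = q.
Proof. by apply/polyP => i; rewrite coef_map /= coef_map_id0. Qed.

Lemma snd_lift_poly q : map_poly snd (lift_poly R q) = map_poly (graph_app R) q.
Proof.
by apply/polyP => i; rewrite coef_map /= !coef_map_id0 ?graph_app0.
Qed.

End Lift.

Lemma fst_poly_over R P : P \is a polyOver (in_subring R) ->
  map_poly fst P \is a polyOver (in_subring (domain_subring R)).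
Proof.
move=> /polyOverP PR; apply/polyOverP => i; rewrite coef_map.
apply/in_subringP; exists (P`_i).2; apply/in_subringP.
by rewrite -surjective_pairing.
Qed.

Lemma horner_pair (P : {poly (F * F)}) x y :
  P.[(x, y)] = ((map_poly fst P).[x], (map_poly snd P).[y]).
Proof.
rewrite [LHS]surjective_pairing.
by rewrite -(horner_map fst P (x, y)) -(horner_map snd P (x, y)).
Qed.

Lemma sub_domain R : is_graph R -> K `<=` domain_subring R.
Proof. by move=> [RK _] k Kk; exists k; exact: RK. Qed.

(** Sending [z] to a root [z'] of the image of its minimal polynomial extends [R], so by maximality
    [z] is already in the domain. *)
Lemma maximal_graph_total R : is_graph R ->
  (forall R', R `<=` R' -> is_graph R' -> R' `<=` R) ->
  forall z, graph_domain R z.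
Proof.
move=> Rg Rmax z; have Rg2 := Rg.2.
have [f fm] := exists_minimal K_field K_alg z (sub_domain Rg).
have [fmon fR fz _] := fm; pose f2 := map_poly snd (lift_poly R f).
have f1 : (1 < size f)%N by apply: root_size_gt1 fz; exact: monic_neq0.
have [z' f2z'] : exists z', root f2 z'.
  apply/closed_rootP; rewrite /f2 size_map_poly_id0.
    by rewrite size_lift_poly // neq_ltn f1 orbT.
  by rewrite (monicP (lift_poly_monic Rg fmon)) /= oner_eq0.
pose R' := adjoin_subring R (z, z').
suff : R' `<=` R by move=> /(_ (z, z'))/(_ (mem_poly_values _ _)); exists z'.
apply: Rmax; first exact: sub_poly_values.
split=> [k Kk|y]; first by apply/sub_poly_values/Rg.1.
have root_w : root (lift_poly R f) (z, z').
  by rewrite rootE horner_pair fst_lift_poly // (rootP fz) (rootP f2z').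
have lmon := lift_poly_monic Rg fmon; have lR := lift_poly_over Rg fR.
move=> /(poly_values_reduce lmon lR root_w).
move=> [P [PR ltP]]; rewrite horner_pair => -[Pz <-].
(* The first components vanish at [z] in degree below that of [f], so they are all [0]; then the
   second components are [0] because [R] is a graph. *)
have P1 : map_poly fst P = 0.
  apply: (minimal_eq0 fm); [exact: fst_poly_over|exact/rootP|].
  by rewrite (leq_ltn_trans (size_poly _ _)) // -(size_lift_poly Rg f).
suff -> : map_poly snd P = 0 by rewrite horner0.
apply/polyP => i; rewrite coef_map coef0; apply: Rg2.
have := congr1 (fun q : {poly F} => q`_i) P1; rewrite coef_map coef0 /= => <-.
by rewrite -surjective_pairing; apply/in_subringP/(polyOverP PR).
Qed.

(** [s] injects the finite root set of a nonzero polynomial over [K] into itself, hence permutes it,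
    and every element of [F] lies in such a set. *)
Lemma endomorphism_bijective (s : {rmorphism F -> F}) :
  (forall k, K k -> s k = k) -> bijective s.
Proof.
move=> sK; have s_inj : injective s := fmorph_inj s.
have s_surj y : exists x, s x = y.
  have [P [P0 PK Py]] := K_alg y.
  have [rs Prs] := closed_field_poly_normal P.
  have rootP_rs x : root P x = (x \in undup rs).
    by rewrite Prs rootZ ?lead_coef_eq0 // root_prod_XsubC mem_undup.
  have sP : map_poly s P = P.
    apply/polyP => i; rewrite coef_map; apply: sK.
    have /polyOverP := PK : P \is a polyOver (in_subring (base_subring K_field)).
    by move=> /(_ i)/in_subringP.
  have s_uniq : uniq (map s (undup rs)) by rewrite map_inj_uniq ?undup_uniq.
  have s_sub : {subset map s (undup rs) <= undup rs}.
    by move=> _ /mapP[x + ->]; rewrite -!rootP_rs -{2}sP fmorph_root.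
  have [|_ e] := uniq_min_size s_uniq s_sub; first by rewrite size_map.
  by have := Py; rewrite rootP_rs -e => /mapP[x _ ->]; exists x.
have [g sg] := choice s_surj.
by exists g => x //; apply: s_inj.
Qed.

Lemma graph_extension R : is_graph R ->
  exists2 s : {rmorphism F -> F}, galois_group K s &
    forall x y, subring_set R (x, y) -> s x = y.
Proof.
(* Being single-valued becomes a condition on individual pairs, as [maximal_subring] requires. *)
move=> Rg; pose Q := [set p : F * F | p.1 = 0 -> p.2 = 0].
have [|M [RM MQ Mmax]] := @maximal_subring _ Q R.
  by move=> [x y] Rxy /= x0; apply: Rg.2; rewrite -x0.
have Mg : is_graph M.
  by split=> [k /Rg.1/RM //|y /MQ /(_ erefl)].
have Mtot x : subring_set M (x, graph_app M x).
  apply/graph_appP/maximal_graph_total => // R' MR' R'g; apply: Mmax => //.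
  by move=> [u w] R'uw /= u0; apply: R'g.2; rewrite -u0.
have ME x y : subring_set M (x, y) -> graph_app M x = y by exact: graph_appE.
have appB : zmod_morphism (graph_app M).
  move=> x y; apply: ME; have /in_subringP Mx := Mtot x.
  by have /in_subringP My := Mtot y; apply/in_subringP; exact: rpredB Mx My.
have appM : monoid_morphism (graph_app M).
  split=> [|x y]; first exact: graph_app1.
  apply: ME; have /in_subringP Mx := Mtot x.
  by have /in_subringP My := Mtot y; apply/in_subringP; exact: rpredM Mx My.
pose addS := GRing.isZmodMorphism.Build F F (graph_app M) appB.
pose mulS := GRing.isMonoidMorphism.Build F F (graph_app M) appM.
pose s : {rmorphism F -> F} := HB.pack (graph_app M) addS mulS.
have sK k : K k -> s k = k by move=> /Rg.1/RM/ME.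
exists s; last by move=> x y /RM/ME.
by split=> //; exact: endomorphism_bijective.
Qed.

Lemma diagonal_closed (E : subring F) :
  subring_closed [in [set p : F * F | subring_set E p.1 /\ p.1 = p.2]].
Proof.
split=> [|p q /set_mem[/in_subringP Ep ep] /set_mem[/in_subringP Eq eq]
  |p q /set_mem[/in_subringP Ep ep] /set_mem[/in_subringP Eq eq]];
  apply/mem_set; split=> /=; rewrite ?ep ?eq //; apply/in_subringP.
- exact: rpred1.
- by rewrite -ep -eq; exact: rpredB.
- by rewrite -ep -eq; exact: rpredM.
Qed.

Definition diagonal (E : subring F) := Subring (diagonal_closed E).

Lemma adjoin_diagonalP (E : subring F) x y p :
  subring_set (adjoin_subring (diagonal E) (x, y)) p ->
  exists2 q, q \is a polyOver (in_subring E) & p = (q.[x], q.[y]).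
Proof.
move=> [P PD <-]; exists (map_poly fst P).
  apply/polyOverP => i; rewrite coef_map.
  by have /in_subringP[Ep _] := polyOverP PD i; apply/in_subringP.
rewrite horner_pair; congr (_, _.[_]).
apply/polyP => i; rewrite !coef_map.
by have /in_subringP[_ /= ->] := polyOverP PD i.
Qed.

(** Sending [q.[x]] to [q.[y]] is well defined, since [f] divides every polynomial over [E] that
    vanishes at [x]; this graph then extends to [F]. *)
Lemma conjugate_extension (E : subring F) x y f : K `<=` E ->
  minimal_over E x f -> root f y ->
  exists2 s : {rmorphism F -> F}, galois_group K s &
    (forall u, subring_set E u -> s u = u) /\ s x = y.
Proof.
move=> KE fm fy; pose R := adjoin_subring (diagonal E) (x, y).
have RE u : subring_set E u -> subring_set R (u, u).
  by move=> Eu; apply: sub_poly_values; split.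
have Rg : is_graph R.
  split=> [k /KE/RE //|z /adjoin_diagonalP[q qE [qx ->]]].
  have [|k ->] := minimal_dvd fm qE; first exact/rootP.
  by rewrite hornerM (rootP fy) mulr0.
have [s sG sR] := graph_extension Rg; exists s => //; split=> [u /RE/sR //|].
by apply: sR; exact: mem_poly_values.
Qed.

End Extension.

(** * Valuations and extension of ramified embeddings *)

Section Valuations.
Variables (G : orderedZmodType) (F : fieldType) (v : valuation F G).
Implicit Types (x y z : F).

Lemma val0 : v 0 = Infty.
Proof. exact: (val_inftyP v 0).2. Qed.

Lemma le_Infty (g : with_top G) : g <= Infty.
Proof. by case: g. Qed.

Lemma lt_Infty x : (v x < Infty) = (x != 0).
Proof.
rewrite lt_neqAle le_Infty andbT; apply/idP/idP; apply: contraNN => /eqP.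
  by move=> ->; rewrite val0.
by move/val_inftyP => ->.
Qed.

Lemma addt_le2r (g h k : with_top G) : g <= h -> g + k <= h + k.
Proof. by case: g h k => [g|] [h|] [k|] //; exact: ozm_leD. Qed.

Lemma val_leM x x' y y' : v x <= v x' -> v y <= v y' ->
  v (x * y) <= v (x' * y').
Proof.
move=> lex ley; rewrite !Defs.valM; apply: le_trans (addt_le2r _ lex) _.
by rewrite ![v x' + _]addrC; exact: addt_le2r.
Qed.

Lemma val_ltM2l z x y : z != 0 -> v x < v y -> v (z * x) < v (z * y).
Proof.
move=> z0; rewrite !ltNge; apply: contraNN => /(val_leM (lexx (v z^-1))).
by rewrite !mulKf.
Qed.

Lemma val_ltM2r z x y : z != 0 -> v x < v y -> v (x * z) < v (y * z).
Proof. by move=> z0 lt; rewrite ![_ * z]mulrC val_ltM2l. Qed.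

Lemma valBC x y : v (x - y) = v (y - x).
Proof. by rewrite -Defs.valN opprB. Qed.

Lemma val_leD g x y : g <= v x -> g <= v y -> g <= v (x + y).
Proof.
by move=> gx gy; rewrite (le_trans _ (Defs.valD v x y)) // le_min gx.
Qed.

Lemma val_ltD g x y : g < v x -> g < v y -> g < v (x + y).
Proof.
by move=> gx gy; rewrite (lt_le_trans _ (Defs.valD v x y)) // lt_min gx.
Qed.

Lemma val_lt_sum g (I : Type) (r : seq I) (P : pred I) (f : I -> F) :
  g < Infty -> (forall i, P i -> g < v (f i)) ->
  g < v (\sum_(i <- r | P i) f i).
Proof.
move=> gI gf; elim/big_ind: _ => //; first by rewrite val0.
by move=> x y; exact: val_ltD.
Qed.

(* [close x y] means [y \in x (1 + M)], where [M] is the maximal ideal of the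
   valuation ring *)
Definition close x y := x = y \/ v x < v (y - x).

Lemma close_refl x : close x x. Proof. by left. Qed.

Lemma close_val x y : close x y -> v y = v x.
Proof.
case=> [->//|lt]; apply/eqP; rewrite eq_le; apply/andP; split; last first.
  by rewrite -[y](subrK x) val_leD // ltW.
rewrite leNgt; apply/negP => lt'.
by move: lt; rewrite valBC => /(val_ltD lt'); rewrite addrC subrK ltxx.
Qed.

Lemma close_eq0 x y : close x y -> x = 0 -> y = 0.
Proof.
by move=> cxy x0; apply/(val_inftyP v); rewrite (close_val cxy) x0 val0.
Qed.

Lemma close_sym x y : close x y -> close y x.
Proof.
move=> cxy; have vyx := close_val cxy; case: cxy => [->|lt]; first by left.
by right; rewrite valBC vyx.
Qed.

Lemma close_trans y x z : close x y -> close y z -> close x z.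
Proof.
move=> cxy; have vyx := close_val cxy; case: cxy => [->//|ltxy].
case=> [<-|ltyz]; first by right.
by right; rewrite -[z](subrK y) -addrA val_ltD // -vyx.
Qed.

Lemma closeM x y x' y' : close x y -> close x' y' -> close (x * x') (y * y').
Proof.
move=> cxy cxy'; have [x0|x0] := eqVneq x 0.
  by rewrite (close_eq0 cxy x0) x0 !mul0r; left.
have [x'0|x'0] := eqVneq x' 0.
  by rewrite (close_eq0 cxy' x'0) x'0 !mulr0; left.
have y0 : y != 0 by apply: contraNneq x0 => /(close_eq0 (close_sym cxy)) ->.
apply: (@close_trans (y * x')).
  case: cxy => [->|lt]; first by left.
  by right; rewrite -mulrBl val_ltM2r.
case: cxy' => [->|lt]; first by left.
by right; rewrite -mulrBr val_ltM2l.
Qed.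

Lemma closeX x y n : close x y -> close (x ^+ n) (y ^+ n).
Proof.
by move=> cxy; elim: n => [|n IH]; [left|rewrite !exprS; exact: closeM].
Qed.

Lemma close_prod (I : Type) (r : seq I) (P : pred I) (f g : I -> F) :
  (forall i, P i -> close (f i) (g i)) ->
  close (\prod_(i <- r | P i) f i) (\prod_(i <- r | P i) g i).
Proof.
move=> fg; elim/big_rec2: _ => [|i x y Pi]; first exact: close_refl.
exact: closeM (fg i Pi).
Qed.

(** The second hypothesis forbids cancellation: each nonzero error [g i - f i] has value above
    [v (f i)], hence above that of the sum. *)
Lemma close_sum (I : finType) (f g : I -> F) :
  (forall i, close (f i) (g i)) -> (forall i, v (\sum_i f i) <= v (f i)) ->
  close (\sum_i f i) (\sum_i g i).
Proof.
move=> fg lef; have [f0|f0] := eqVneq (\sum_i f i) 0.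
  left; rewrite f0 big1 // => i _; apply: (close_eq0 (fg i)).
  by apply/(val_inftyP v)/eqP; rewrite eq_le le_Infty -val0 -{1}f0 lef.
right; rewrite -sumrB; apply: val_lt_sum => [|i _]; first by rewrite lt_Infty.
case: (fg i) => [->|lt]; first by rewrite subrr val0 lt_Infty.
exact: le_lt_trans (lef i) lt.
Qed.

Lemma val_prod_le (r : seq F) x (f : F -> F) :
  (forall z, z \in r -> v (f z) <= v x) ->
  v (\prod_(z <- r) f z) <= v (x ^+ size r).
Proof.
elim: r => [|z r IH] lef /=; first by rewrite big_nil expr0.
rewrite big_cons exprS val_leM //; first by apply: lef; rewrite mem_head.
by apply: IH => u ur; apply: lef; rewrite in_cons ur orbT.
Qed.

End Valuations.

(** If no root [z] is close to [y], each factor [y - z] has value at most [v y], so the product has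
    value at most that of [y ^+ (size f).-1]. *)
Lemma close_root (G : orderedZmodType) (F : closedFieldType)
    (v : valuation F G) (f : {poly F}) y :
  f \is monic -> v (y ^+ (size f).-1) < v f.[y] ->
  exists2 z, root f z & close v y z.
Proof.
move=> fmon lt; have [rs frs] := closed_field_poly_normal f.
rewrite (monicP fmon) scale1r in frs.
apply: contrapT => nz; have : v f.[y] <= v (y ^+ (size f).-1).
  rewrite {1 2}frs horner_prod size_prod_XsubC /=; apply: val_prod_le => z zrs.
  rewrite hornerXsubC leNgt; apply/negP => ltz; apply: nz; exists z.
    by rewrite frs root_prod_XsubC.
  by right; rewrite valBC.
by rewrite leNgt lt.
Qed.

(** * Automorphisms over a henselian field *)

Section Henselian.
Variables (G : orderedZmodType) (F : closedFieldType) (v : valuation F G).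
Variable K : set F.
Hypotheses (K_closure : algebraic_closure_of K) (hens : henselian v K).

Let K_field : subfield K := proj1 K_closure.
Let K_alg : forall x, algebraic_elt K x := proj2 K_closure.

(** [v \o s] is again a valuation extending the restriction of [v] to [K], so it is [v]. *)
Lemma galois_val (s : {rmorphism F -> F}) x : galois_group K s -> v (s x) = v x.
Proof.
move=> [_ sK]; pose w := @Valuation F G (v \o s).
have w0 x' : v (s x') = Infty <-> x' = 0.
  split=> [/val_inftyP/eqP|->]; last by rewrite rmorph0 val0.
  by rewrite fmorph_eq0 => /eqP.
have wM x' y : v (s (x' * y)) = v (s x') + v (s y) by rewrite rmorphM Defs.valM.
have wD x' y : Order.min (v (s x')) (v (s y)) <= v (s (x' + y)).
  by rewrite rmorphD Defs.valD.
by apply: (hens (w := w w0 wM wD)) => k Kk /=; rewrite sK.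
Qed.

Lemma close_graph (R : subring (F * F)%type) :
  (forall k, K k -> subring_set R (k, k)) ->
  (forall p, subring_set R p -> close v p.1 p.2) -> is_graph K R.
Proof. by move=> RK Rc; split=> // y /Rc c0y; exact: (close_eq0 c0y). Qed.

(* A polynomial [P] of least degree over the domain of [R] whose value at [y] has
   a larger valuation than one of its terms makes the lower powers of [y]
   valuation independent, so sending a root of [P] close to [y] to such a root
   of its image extends [R]. *)
Lemma maximal_close_dense (R : subring (F * F)%type) :
  (forall k, K k -> subring_set R (k, k)) ->
  (forall p, subring_set R p -> close v p.1 p.2) ->
  (forall R' : subring (F * F)%type, R `<=` R' ->
     (forall p, subring_set R' p -> close v p.1 p.2) -> R' `<=` R) ->
  forall y, y != 0 -> exists2 e, graph_domain R e & close v y e.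
Proof.
move=> RK Rc Rmax y y0; have Rg := close_graph RK Rc.
have yX0 i : y ^+ i != 0 by rewrite expf_neq0.
set D := domain_subring R; have KD : K `<=` D := sub_domain Rg.
pose dep (P : {poly F}) := exists i, v (P`_i * y ^+ i) < v P.[y].
pose good n := `[< exists P, [/\ P \is a polyOver (in_subring D), dep P &
  size P = n] >].
(* A nonzero polynomial annihilating [y] qualifies: its value at [y] is infinite, that of its
   leading term is not. *)
have [n gn] : exists n, good n.
  have [P [P0 PK Py]] := K_alg y; exists (size P); apply/asboolP; exists P.
  split=> //.
    by apply: polyOverS PK => k /set_mem Kk; exact/in_subringP/KD.
  exists (size P).-1; rewrite (rootP Py) val0 lt_Infty mulf_neq0 //.
  by rewrite -lead_coefE lead_coef_eq0.
case: (ex_minnP (ex_intro _ n gn)) => {gn}n /asboolP[P [PD [i0 Pi0] sP]] minn.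
have indep Q i : Q \is a polyOver (in_subring D) -> (size Q < size P)%N ->
    v Q.[y] <= v (Q`_i * y ^+ i).
  move=> QD ltQ; rewrite leNgt; apply/negP => lt.
  move: ltQ; rewrite sP ltnNge minn //; apply/asboolP; exists Q; split=> //.
  by exists i.
have P0 : P != 0.
  apply: contraTneq Pi0 => ->; by rewrite coef0 mul0r horner0 ltxx.
pose c := lead_coef P; pose m := (size P).-1.
have c0 : c != 0 by rewrite lead_coef_eq0.
have cD : c \in in_subring D by exact: (polyOverP PD).
(* If some term lay below the leading one, dropping the leading term would leave a shorter
   polynomial that still cancels at [y]. *)
have lead_min i : v (c * y ^+ m) <= v (P`_i * y ^+ i).
  rewrite leNgt; apply/negP => lti.
  have [j [ltj ltPj]] : exists j, v (P`_j * y ^+ j) < v (c * y ^+ m) /\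
      v (P`_j * y ^+ j) < v P.[y].
    have [le|lt] := leP (v (P`_i * y ^+ i)) (v (P`_i0 * y ^+ i0)).
      by exists i; split=> //; exact: le_lt_trans le Pi0.
    by exists i0; split=> //; exact: lt_trans lt lti.
  have jm : j != m.
    by apply: contraTneq ltj => ->; rewrite /c lead_coefE ltxx.
  have := @indep (P - c *: 'X^m) j.
  rewrite coefB coefZ coefXn (negPf jm) mulr0 subr0 hornerD hornerN hornerZ.
  rewrite hornerXn leNgt val_ltD ?Defs.valN // => bad.
  suff : ~~ true by []; apply: bad.
    by rewrite rpredB // polyOverZ ?polyOverXn.
  rewrite -[size P]prednK ?size_poly_gt0 // ltnS; apply/leq_sizeP => k.
  rewrite coefB coefZ coefXn leq_eqVlt => /orP[/eqP <-|ltk].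
    by rewrite eqxx mulr1 subrr.
  rewrite nth_default ?gtn_eqF // ?mulr0 ?subr0 //.
  by rewrite -(@prednK (size P)) ?size_poly_gt0.
pose f := c^-1 *: P.
have cVD : c^-1 \in in_subring D.
  apply/in_subringP; apply: (subring_inv K_field K_alg KD); exact/in_subringP.
have fD : f \is a polyOver (in_subring D) by rewrite polyOverZ.
have fmon : f \is monic by rewrite monicE lead_coefZ mulVf.
have sf : size f = size P by rewrite size_scale ?invr_eq0.
have fi i : v (y ^+ m) <= v (f`_i * y ^+ i).
  have := val_leM (lexx (v c^-1)) (lead_min i).
  by rewrite mulKf // coefZ mulrA.
have fy : v (y ^+ m) < v f.[y].
  have := val_ltM2l (_ : c^-1 != 0) (le_lt_trans (lead_min i0) Pi0).
  by rewrite mulKf // hornerZ; apply; rewrite invr_eq0.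
pose f2 := map_poly (graph_app R) f.
have f2E : f2 = map_poly snd (lift_poly R f) by rewrite (snd_lift_poly Rg).
have f2_mon : f2 \is monic.
  by rewrite f2E monic_map // (lift_poly_monic Rg).
have sf2 : size f2 = size f.
  rewrite f2E size_map_poly_id0 ?(size_lift_poly Rg) //.
  by rewrite (monicP (lift_poly_monic Rg fmon)) oner_eq0.
have Rf i : close v f`_i f2`_i.
  rewrite coef_map_id0 ?(graph_app0 Rg) //.
  apply: (Rc (f`_i, graph_app R f`_i)); apply: graph_appP.
  exact: (@in_subringP _ D _ (polyOverP fD i)).
(* The coefficients of [f2] are close to those of [f], so [f2 - f] also has value above [v (y ^+ m)]
   at [y]. *)
have f2y : v (y ^+ m) < v f2.[y].
  rewrite -[f2](subrK f) hornerD val_ltD // horner_coef val_lt_sum ?lt_Infty //.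
  move=> i _; rewrite coefB; case: (Rf i) => [->|lt].
    by rewrite subrr mul0r val0 lt_Infty.
  by apply: le_lt_trans (fi i) _; rewrite val_ltM2r.
have [|z fz cz] := close_root fmon (y := y) (v := v); first by rewrite sf.
have [|z' f2z' cz'] := close_root f2_mon (y := y) (v := v).
  by rewrite sf2 sf.
pose R' := adjoin_subring R (z, z').
suff R'R : R' `<=` R.
  by exists z => //; exists z'; apply: R'R; exact: mem_poly_values.
apply: Rmax => [|p]; first exact: sub_poly_values.
have root_w : root (lift_poly R f) (z, z').
  by rewrite rootE horner_pair (fst_lift_poly Rg) (rootP fz) -f2E (rootP f2z').
have lmon := lift_poly_monic Rg fmon; have lR := lift_poly_over Rg fD.
move=> /(poly_values_reduce lmon lR root_w).
move=> [Q [QR]]; rewrite (size_lift_poly Rg) sf => ltQ <-.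
rewrite horner_pair /=; set Q1 := map_poly fst Q; set Q2 := map_poly snd Q.
have Q1D : Q1 \is a polyOver (in_subring D) by exact: fst_poly_over.
have sQ1 : (size Q1 <= size Q)%N by exact: size_poly.
have sQ2 : (size Q2 <= size Q)%N by exact: size_poly.
(* Below the size of [P] there is no cancellation at [y], so termwise closeness passes to the
   values. *)
have Q1y (q : {poly F}) u : (size q <= size Q)%N -> close v y u ->
    (forall i, close v Q1`_i q`_i) -> close v Q1.[y] q.[u].
  move=> sq cyu cq; rewrite !(@horner_coef_wide _ (size Q)) //.
  apply: close_sum => i; first by apply: closeM => //; exact: closeX.
  rewrite -horner_coef_wide //; apply: indep => //; exact: leq_ltn_trans ltQ.
apply: (@close_trans _ _ _ Q1.[y]).
  by apply/close_sym/Q1y => // i; left.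
apply: Q1y => // i; rewrite !coef_map; apply: Rc.
exact/in_subringP/(polyOverP QR).
Qed.

(** Take [s] from a maximal close graph and [e] in its domain close to [x]: then [x], [e], [s e],
    [s x] are successively close, the last two because [s] preserves [v]. *)
Lemma close_extension (R : subring (F * F)%type) :
  (forall k, K k -> subring_set R (k, k)) ->
  (forall p, subring_set R p -> close v p.1 p.2) ->
  exists2 s : {rmorphism F -> F}, galois_group K s &
    (forall x y, subring_set R (x, y) -> s x = y) /\
    forall x, close v x (s x).
Proof.
move=> RK Rc.
have [//|M [RM Mc Mmax]] := @maximal_subring _ [set p | close v p.1 p.2] R.
have MK k : K k -> subring_set M (k, k) by move=> /RK/RM.
have [s sG sM] := graph_extension K_closure (close_graph MK Mc).
exists s => //; split=> [x y /RM/sM //|x].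
have [->|x0] := eqVneq x 0; first by rewrite rmorph0; left.
have [e [e' Mee'] xe] := maximal_close_dense MK Mc Mmax x0.
apply: (close_trans xe); apply: (close_trans (Mc _ Mee')) => /=.
rewrite -(sM _ _ Mee'); apply: close_sym; case: xe => [->|lt]; first by left.
by right; rewrite -rmorphB !galois_val.
Qed.

End Henselian.

(** * Elements of K(a) are separable *)

(** The root field of [p] embeds into [F] with its generator going to [a]; there, everything
    generated by a separable element is separable, and this is carried over to [F]. *)
Lemma separable_poly_value (k F : fieldType) (iota : {rmorphism k -> F})
    (p : {poly k}) (a : F) :
  root (map_poly iota p) a -> p != 0 ->
  (forall q, root (map_poly iota q) a -> q != 0 -> (size p <= size q)%N) ->
  separable_poly p -> forall q : {poly k}, exists2 g : {poly k},
    separable_poly g & root (map_poly iota g) (map_poly iota q).[a].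
Proof.
move=> pa p0 pmin psep q.
have irr_p : irreducible_poly p by apply/(subfx_irreducibleP pa p0).
pose L : fieldExtType k := SubFieldExtType pa irr_p.
pose inj : {rmorphism L -> F} := @subfx_inj k F iota a p.
have injA b : inj (in_alg L b) = iota b by exact: (subfx_inj_base pa p0).
have injP (g : {poly k}) x :
    inj (map_poly (in_alg L) g).[x] = (map_poly iota g).[inj x].
  rewrite -horner_map -map_poly_comp; congr (_.[_]).
  exact: eq_map_poly.
pose z : L := subfx_root iota a p.
have injz : inj z = a by exact: subfx_inj_root.
have sepz : separable_element 1%AS z.
  apply/separable_elementP; exists (map_poly (in_alg L) p); split.
  - by apply/polyOver1P; exists p.
  - by rewrite -(fmorph_root inj) /root horner_map injP injz.
  - by rewrite separable_map.
have /(adjoin_separableP sepz) : (map_poly (in_alg L) q).[z] \in <<1%AS; z>>%VS.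
  apply/Fadjoin_polyP; exists (map_poly (in_alg L) q) => //.
  by apply/polyOver1P; exists q.
move=> /separable_elementP[_ [/polyOver1P[g ->] gz]]; rewrite separable_map.
exists g => //; move: gz.
by rewrite -(fmorph_root inj) /root horner_map injP injP injz.
Qed.

Section SeparableAdjunction.
Variables (F : fieldType) (K : set F).
Hypotheses (K_field : subfield K) (K_alg : forall x, algebraic_elt K x).

Definition base_pred : {pred F} := [in K].

HB.instance Definition _ := GRing.isDivringClosed.Build F base_pred K_field.

Record base_field := BaseField { base_val : F; _ : base_val \in base_pred }.

HB.instance Definition _ := [isSub for base_val].
HB.instance Definition _ := [Choice of base_field by <:].
HB.instance Definition _ := [SubChoice_isSubIntegralDomain of base_field by <:].
HB.instance Definition _ := [SubIntegralDomain_isSubField of base_field by <:].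

Let iota : {rmorphism base_field -> F} := \val.

Lemma map_base_poly_over (p : {poly base_field}) :
  map_poly iota p \is a polyOver [in K].
Proof.
by apply/(polyOverP (S := base_pred)) => i; rewrite coef_map; exact: valP.
Qed.

Lemma polyOver_base (q : {poly F}) : q \is a polyOver [in K] ->
  exists p, map_poly iota p = q.
Proof.
move=> /(polyOverP (S := base_pred)) qK.
exists (\poly_(i < size q) BaseField (qK i)); apply/polyP => i.
rewrite coef_map coef_poly; case: ltnP => [//|le].
by rewrite nth_default //; exact: (rmorph0 iota).
Qed.

Lemma separable_adjoin a x :
  separable_elt K a -> adjoin K a x -> separable_elt K x.
Proof.
move=> [f [fmon fK fa fdvd] fsep].
rewrite (adjoinE K_field K_alg (E := base_subring K_field)) //.
move=> [_ /polyOver_base[q <-] <-].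
have [p ep] := polyOver_base fK.
have p0 : p != 0.
  by rewrite -(map_poly_eq0 iota) ep monic_neq0.
have psep : separable_poly p by rewrite -(separable_map iota) ep.
have pa : root (map_poly iota p) a by rewrite ep.
have pmin r : root (map_poly iota r) a -> r != 0 -> (size p <= size r)%N.
  move=> ra r0; rewrite -(size_map_poly iota p) -(size_map_poly iota r) ep.
  by rewrite dvdp_leq ?map_poly_eq0 // fdvd // map_base_poly_over.
have [g gsep gx] := separable_poly_value pa p0 pmin psep q.
have [h hm] := exists_minimal K_field K_alg (E := base_subring K_field)
  (map_poly iota q).[a] (fun _ => id).
have hdvd r : r \is a polyOver [in K] -> root r (map_poly iota q).[a] -> h %| r.
  by move=> rK rx; have [u ->] := minimal_dvd hm rK rx; rewrite dvdp_mull.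
have [hmon hK hx _] := hm; exists h; first by split.
apply: (@dvdp_separable _ (map_poly iota g)); last by rewrite separable_map.
by apply: hdvd gx; exact: map_base_poly_over.
Qed.

End SeparableAdjunction.

(** * Counting conjugates in balls *)

(** Double counting of the pairs [(c, u)] with [f c = u]. *)
Lemma size_fibers (T U : eqType) (X : seq T) (f : T -> U) n :
  (forall b, b \in X -> count (fun c => f c == f b) X = n) ->
  size X = (size (undup (map f X)) * n)%N.
Proof.
have countE (V : Type) (P : pred V) s : count P s = (\sum_(i <- s) P i)%N.
  by elim: s => [|x s IH]; rewrite ?big_nil ?big_cons //= IH.
move=> fn; set W := undup (map f X).
have fW b : b \in X -> f b \in W by move=> bX; rewrite mem_undup map_f.
transitivity (\sum_(c <- X) \sum_(u <- W) (f c == u))%N.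
  rewrite -sum1_size !big_seq; apply: eq_bigr => c cX.
  rewrite -(countE _ (fun u => f c == u)) (eq_count (a2 := pred1 (f c))).
    by rewrite count_uniq_mem ?undup_uniq // fW.
  by move=> u; rewrite /= eq_sym.
rewrite exchange_big /= -sum1_size big_distrl /= !big_seq.
apply: eq_bigr => u; rewrite mem_undup => /mapP[b bX ->].
by rewrite -(countE _ (fun c => f c == f b)) fn // mul1n.
Qed.

Section ResidueMap.
Variables (F : closedFieldType) (G : orderedZmodType) (v : valuation F G).
Implicit Types x y : F.

(** Elements outside the valuation ring get the residue of [0] as a default. *)
Definition res x : residue_field v := residue (insubd (0 : valring v) x).

Lemma resB x y : Fin 0 <= v x -> Fin 0 <= v y -> res (x - y) = res x - res y.
Proof.
move=> x0 y0; rewrite /res /residue -rmorphB; congr (\pi _)%qT; apply: val_inj.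
rewrite rmorphB /= !insubdK //; last exact: rpredB.
Qed.

Lemma res_eq0 x : Fin 0 <= v x -> (res x == 0) = (Fin 0 < v x).
Proof. by move=> x0; rewrite residue_eq0 unfold_in /= insubdK. Qed.

Lemma res1 : res 1 = 1.
Proof.
rewrite /res /residue -(rmorph1 \pi_(residue_field v)%qT).
congr (\pi _)%qT; apply: val_inj; rewrite /= insubdK //; exact: rpred1.
Qed.

(** A vanishing positive multiple of [1] forces positive characteristic, so the exponent is that
    prime and not its default [1]. *)
Lemma resid_char_dvd n : (0 < n)%N -> n%:R = 0 :> residue_field v ->
  prime (resid_char_exponent v) /\ (resid_char_exponent v %| n)%N.
Proof.
move=> n0 /eqP nr; have [p pP] := natf0_pchar n0 nr.
have rP : resid_char_exponent v \in [pchar (residue_field v)].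
  exact: (@xgetI _ 1%N [set q | q \in [pchar (residue_field v)]] p pP).
by rewrite (dvdn_pcharf rP) nr (pcharf_prime rP).
Qed.

End ResidueMap.

Section Balls.
Variables (F : closedFieldType) (G : orderedZmodType) (v : valuation F G).
Variables (X : seq F) (a : F).
Hypotheses (X_uniq : uniq X) (aX : a \in X).

Definition isometry_of (s : F -> F) :=
  perm_eq (map s X) X /\ forall x y, v (s x - s y) = v (x - y).

Hypothesis X_homogeneous :
  forall b, b \in X -> exists2 s, isometry_of s & s a = b.

Implicit Types D : with_top G -> bool.

(** Such conditions cover closed balls, open balls and all of [X] at once. *)
Definition upward D := D Infty /\ forall g h, g <= h -> D g -> D h.

Lemma upwardD D x y : upward D -> D (v x) -> D (v y) -> D (v (x + y)).
Proof.
move=> [_ Dup] Dx Dy; apply: Dup (Defs.valD v x y) _.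
by rewrite minEle; case: ifP.
Qed.

Definition ball_size D b := count (fun c => D (v (c - b))) X.

Lemma ball_size_homogeneous D b : b \in X -> ball_size D b = ball_size D a.
Proof.
move=> /X_homogeneous[s [sX sv] <-].
rewrite /ball_size -(permP sX) count_map; apply: eq_count => c /=.
by rewrite sv.
Qed.

(** By the ultrametric inequality the larger ball is partitioned into [D]-balls, which all have the
    same size by homogeneity. *)
Lemma ball_size_dvd D D' : upward D -> upward D' ->
  (forall g, D g -> D' g) -> (ball_size D a %| ball_size D' a)%N.
Proof.
move=> uD uD' DD'; pose Y := [seq c <- X | D' (v (c - a))].
pose f b := [seq c <- X | D (v (c - b))].
have Dsym x y : D (v (x - y)) = D (v (y - x)) by rewrite valBC.
have fE b c : b \in X -> c \in X -> (f c == f b) = D (v (c - b)).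
  move=> bX cX; apply/eqP/idP => [fcb|Dcb].
    have : c \in f c by rewrite mem_filter cX subrr val0 uD.1.
    by rewrite fcb mem_filter => /andP[].
  apply: eq_filter => e; apply/idP/idP => De.
    by rewrite -[e](subrK c) -addrA; exact: upwardD.
  by rewrite -[e](subrK b) -addrA; apply: upwardD; rewrite // Dsym.
rewrite /(ball_size D') -size_filter -/Y.
rewrite (@size_fibers _ _ Y f (ball_size D a)) ?dvdn_mull // => b.
rewrite mem_filter => /andP[Db bX]; rewrite -(ball_size_homogeneous D bX).
rewrite /Y count_filter; apply: eq_in_count => c cX /=; rewrite fE //.
apply/andP/idP => [[]//|Dcb]; split=> //.
by rewrite -[c](subrK b) -addrA; apply: upwardD => //; exact: DD'.
Qed.

Lemma upward_ge g : upward (>= g)%O.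
Proof. by split=> [|h k hk gh]; [exact: le_Infty|exact: le_trans hk]. Qed.

Lemma upward_gt g : g < Infty -> upward (> g)%O.
Proof. by move=> gI; split=> // h k hk gh; exact: lt_le_trans hk. Qed.

(* The residues of [(b - a) / c], for [b] in the closed ball of radius [v c]
   about [a], form a finite set stable under translation by [1]; summing over
   it shows that its cardinality vanishes in the residue field. *)
Lemma ball_size_step s : perm_eq (map s X) X -> s a != a ->
  (forall x y, s (x - y) = s x - s y) -> (forall x, close v x (s x)) ->
  let p := resid_char_exponent v in let g := v (s a - a) in
  prime p /\
  (p * ball_size (> g)%O a %| ball_size (>= g)%O a)%N.
Proof.
move=> sX sa sB sc p g; pose c := s a - a.
have c0 : c != 0 by rewrite subr_eq0.
have gI : g < Infty by rewrite lt_Infty.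
pose Y := [seq b <- X | g <= v (b - a)]; pose f b := res v ((b - a) / c).
have divc x : (Fin 0 <= v (x / c)) = (g <= v x).
  rewrite -(Defs.val1 v); apply/idP/idP => [/(val_leM (lexx g))|].
    by rewrite mulr1 mulrCA divff // mulr1.
  by move=> /val_leM/(_ (lexx (v c^-1))); rewrite divff.
have divc_gt x : (Fin 0 < v (x / c)) = (g < v x).
  rewrite -(Defs.val1 v); apply/idP/idP => [/(val_ltM2l c0)|].
    by rewrite mulr1 mulrCA divff // mulr1.
  by move=> /(@val_ltM2r _ _ _ c^-1); rewrite divff //; apply; rewrite invr_eq0.
have memY b : b \in Y = (g <= v (b - a)) && (b \in X) by rewrite mem_filter.
have fE b b' : b \in Y -> b' \in Y -> (f b == f b') = (g < v (b - b')).
  rewrite !memY => /andP[gb _] /andP[gb' _]; rewrite -subr_eq0 -resB ?divc //.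
  rewrite -mulrBl opprB addrA subrK res_eq0 ?divc_gt // divc.
  by rewrite -[b](subrK a) -addrA val_leD // valBC.
(* Residues agree exactly at distance above [g], so the fibres of [f] are open balls. *)
have fibers : size Y = (size (undup (map f Y)) * ball_size (> g)%O a)%N.
  apply: size_fibers => b bY; have := bY; rewrite memY => /andP[gb bX].
  rewrite -(ball_size_homogeneous _ bX) /ball_size /Y count_filter.
  apply: eq_in_count => c' c'X /=; apply/andP/idP => [[fcb gc']|lt].
    by rewrite -fE // memY gc'.
  have gc' : g <= v (c' - a).
    by rewrite -[c'](subrK b) -addrA val_leD // ltW.
  by rewrite fE // memY gc'.
(* The error in [f (s b) = f b + 1] is the residue of [(s (b - a) - (b - a)) / c], which vanishes
   since [s (b - a)] is close to [b - a]. *)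
have fs b : b \in Y -> s b \in Y /\ f (s b) = f b + 1.
  move=> bY; have := bY; rewrite memY => /andP[gb bX].
  have gsb : g <= v (s b - a).
    rewrite -[s b](subrK (s a)) -addrA val_leD // -sB.
    by rewrite (close_val (sc (b - a))).
  split; first by rewrite memY gsb -(perm_mem sX) map_f.
  apply/eqP; rewrite -subr_eq0 opprD addrA -(res1 v).
  have gsbb : g <= v (s b - b).
    by rewrite -[s b](subrK a) -addrA val_leD // valBC.
  have divB : (s b - a) / c - (b - a) / c = (s b - b) / c.
    by rewrite -mulrBl opprB addrA subrK.
  rewrite /f -!resB ?divc ?divB ?divc ?(Defs.val1 v) //.
  have -> : (s b - b) / c - 1 = (s (b - a) - (b - a)) / c.
    rewrite -[1](divff c0) -mulrBl sB /c; congr (_ / _).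
    by rewrite !opprB !addrA; ring.
  have gs : g < v (s (b - a) - (b - a)).
    by case: (sc (b - a)) => [<-|/(le_lt_trans gb)//]; rewrite subrr val0.
  by rewrite res_eq0 ?divc_gt // divc ltW.
set W := undup (map f Y) in fibers.
have W_stable : perm_eq [seq w + 1 | w <- W] W.
  have W1_uniq : uniq [seq w + 1 | w <- W].
    by rewrite map_inj_uniq ?undup_uniq //; exact: addIr.
  have W1_sub : {subset [seq w + 1 | w <- W] <= W}.
    move=> _ /mapP[w + ->]; rewrite !mem_undup => /mapP[b bY ->].
    by have [sbY <-] := fs b bY; exact: map_f.
  have [|_ W1] := uniq_min_size W1_uniq W1_sub; first by rewrite size_map.
  by apply: uniq_perm => //; exact: undup_uniq.
have Wsz0 : (size W)%:R = 0 :> residue_field v.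
  have : \sum_(w <- [seq w + 1 | w <- W]) w = \sum_(w <- W) w.
    exact: perm_big.
  rewrite big_map big_split /= big_const_seq count_predT iter_addr addr0.
  by rewrite -[X in _ = X]addr0 => /addrI.
have Wsz : (0 < size W)%N.
  have : f a \in W by rewrite mem_undup map_f // memY aX subrr val0 le_Infty.
  by case: (W).
have [p_prime pW] := resid_char_dvd Wsz Wsz0; split=> //.
rewrite [ball_size _ a in X in (_ %| X)%N]/ball_size -size_filter fibers.
exact: dvdn_mul.
Qed.

Definition step_value g := exists s, [/\ perm_eq (map s X) X, s a != a,
  forall x y, s (x - y) = s x - s y, forall x, close v x (s x) &
  v (s a - a) = g].

(** For the least distance [g], the [D]-ball is a union of closed balls of radius [g]; each gains a
    factor [p] over the open ball, to which the larger distances apply inductively. *)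
Lemma ball_chain (gs : seq (with_top G)) D : sorted <%O gs ->
  (forall g, g \in gs -> step_value g) -> upward D -> all D gs ->
  (resid_char_exponent v ^ size gs %| ball_size D a)%N.
Proof.
elim: gs D => [|g gs IH] D; first by rewrite expn0 dvd1n.
move=> /= path_gs gsP uD /andP[Dg Dgs].
have [s [sX sa sB sc sg]] := gsP g (mem_head _ _).
have gI : g < Infty by rewrite -sg lt_Infty subr_eq0.
have [_] := ball_size_step sX sa sB sc; rewrite sg => step.
rewrite expnS (dvdn_trans _ (dvdn_trans step _)) //.
  apply: dvdn_mul => //; apply: IH; first exact: path_sorted path_gs.
  - by move=> h hgs; apply: gsP; rewrite in_cons hgs orbT.
  - exact: upward_gt.
  - exact: order_path_min lt_trans path_gs.
by apply: ball_size_dvd => // [|h gh]; [exact: upward_ge|exact: uD.2 gh Dg].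
Qed.

Lemma step_values_bound (gs : seq (with_top G)) : uniq gs ->
  (forall g, g \in gs -> step_value g) ->
  (size gs <= logn (resid_char_exponent v) (size X))%N.
Proof.
move=> gs_uniq gsP; have [->//|gs0] := eqVneq gs [::].
(* A single step already forces primality; at the default exponent [1], [logn] would be [0]. *)
have p_prime : prime (resid_char_exponent v).
  case: gs gs0 gsP {gs_uniq} => // g gs _ /(_ g (mem_head _ _)).
  by move=> [s [sX sa sB sc _]]; have [] := ball_size_step sX sa sB sc.
have X0 : (0 < size X)%N by case: (X) aX.
rewrite -pfactor_dvdn // -(size_sort <=%O gs) -(count_predT X).
apply: (@ball_chain _ xpredT); rewrite ?sort_lt_sorted //.
- by move=> g; rewrite mem_sort; exact: gsP.
- exact: all_predT.
Qed.

End Balls.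

(** * Pure elements *)

Section Purity.
Variables (G : orderedZmodType) (F : closedFieldType) (v : valuation F G).
Variables (K : set F) (a : F).
Hypotheses (K_closure : algebraic_closure_of K) (hens : henselian v K).
Hypotheses (a_sep : separable_elt K a) (a_pure : pure v K a).

Let K_field : subfield K := proj1 K_closure.
Let K_alg : forall x, algebraic_elt K x := proj2 K_closure.
Let KS : subring F := base_subring K_field.
Let KKS : K `<=` KS := @subset_refl _ K.

(** In an Okutsu sequence of length [1] the set [A 1] consists of elements of degree [1], that is,
    of [K]. *)
Lemma pure_base_distance z : (degree K z < degree K a)%N ->
  exists2 k, K k & v (a - z) <= v (a - k).
Proof.
have [A [d Ad]] : exists A d, okutsu_sequence v K a 1 A d.
  (* Depth [1] is not the default [0], so a sequence of this length exists. *)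
  move: a_pure; rewrite /pure /depth; case: xgetP => // n -> P n1.
  by rewrite n1 in P.
rewrite -(okutsu_degree_first Ad) => ltz.
have [k Ak le] := okutsu_cofinal Ad (isT : (0 < 1)%N) ltz.
exists k => //; apply: (@degree1_mem F K K_field K_alg KS) => //.
by rewrite (okutsu_degree Ad _ Ak) // (okutsu_degree_last Ad).
Qed.

Lemma conjugate_close s : galois_group K s ->
  (forall k, K k -> v (a - k) < v (s a - a)) ->
  exists2 t, galois_group K t & t a = s a /\ forall x, close v x (t x).
Proof.
move=> sG sa; pose R := adjoin_subring (diagonal KS) (a, s a).
have RK k : K k -> subring_set R (k, k).
  by move=> Kk; apply: sub_poly_values; split.
have [f fm] := exists_minimal K_field K_alg a KKS.
have [fmon fK fa _] := fm; have sK := sG.2.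
have sf : map_poly s f = f.
  apply/polyP => i; rewrite coef_map; apply: sK.
  exact/(@in_subringP _ KS)/(polyOverP fK).
have fsa : root f (s a) by rewrite -sf fmorph_root.
have [p /adjoin_diagonalP[q qK ->]|t tG [tR tc]] :=
    close_extension K_closure hens RK.
  (* Both [a] and [s a] are roots of [f], so only the remainder [r] matters, and it is compared
     factor by factor. *)
  have [u [r [uK rK -> ltr]]] := polyOver_divmod fmon fK qK.
  rewrite /= !hornerD !hornerM (rootP fa) (rootP fsa) !mulr0 !add0r.
  have [->|r0] := eqVneq r 0; first by rewrite !horner0; left.
  have [rs ers] := closed_field_poly_normal r.
  have rootr x : x \in rs -> root r x.
    by rewrite [r in root r]ers rootZ ?lead_coef_eq0 // root_prod_XsubC.
  rewrite ers !hornerZ !horner_prod; apply: closeM; first by left.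
  rewrite !big_seq; apply: close_prod => x /rootr rx; rewrite !hornerXsubC.
  right; rewrite opprB addrA subrK.
  have [g gm] := exists_minimal K_field K_alg x KKS.
  have [gmon _ _ gmin] := gm.
  (* As a root of [r], [x] has smaller degree than [a], so purity gives
     [v (a - x) <= v (a - k) < v (s a - a)]. *)
  have [|k Kk /le_lt_trans] := @pure_base_distance x; last by apply; exact: sa.
  rewrite (degree_minimal K_field K_alg KKS gm).
  rewrite (degree_minimal K_field K_alg KKS fm).
  have := leq_ltn_trans (gmin r rK rx r0) ltr.
  have : (0 < size g)%N by rewrite size_poly_gt0 monic_neq0.
  by case: (size g) => // m _; case: (size f).
exists t => //; split=> //; apply: tR; exact: mem_poly_values.
Qed.

(** Elements of [adjoin K a] inherit separability from [a], so only invariance under the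
    ramification group remains, and this is stable under ring operations. *)
Lemma ramified_closed :
  subring_closed [in adjoin K a `&` ramification_field v K].
Proof.
set A := adjoin_subring KS a.
have aE : adjoin K a = A by exact: (@adjoinE F K K_field K_alg KS a KKS).
have memP x : x \in [in adjoin K a `&` ramification_field v K] <->
    x \in in_subring A /\
    (forall s : {rmorphism F -> F}, ramification_group v K s -> s x = x).
  split=> [/set_mem[xa [_ xr]]|[/in_subringP xA xr]].
    by split=> //; apply/in_subringP; rewrite -aE.
  apply/mem_set; rewrite aE; split=> //; split=> //.
  by apply: (separable_adjoin K_field K_alg a_sep); rewrite aE.
split=> [|x y /memP[xA xr] /memP[yA yr]|x y /memP[xA xr] /memP[yA yr]];
  apply/memP; split=> [|s sr].
- exact: rpred1.
- exact: rmorph1.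
- exact: rpredB.
- by rewrite rmorphB xr // yr.
- exact: rpredM.
- by rewrite rmorphM xr // yr.
Qed.

Let LS : subring F := Subring ramified_closed.

Lemma base_sub_ramified : K `<=` LS.
Proof.
move=> k Kk; split.
  by rewrite (@adjoinE F K K_field K_alg KS a KKS); exact: sub_poly_values.
split=> [|s [[_ sK] _]]; last exact: sK.
exists ('X - k%:P); last first.
  by have := separable_prod_XsubC [:: k]; rewrite big_seq1.
split; rewrite ?monicXsubC ?root_XsubC //.
  have : 'X - k%:P \is a polyOver (in_subring KS); last by [].
  by rewrite polyOverXsubC; exact/in_subringP.
by move=> q _; rewrite dvdp_XsubCl.
Qed.

(** With [b = s a], [b - a] is the difference of [s (a - k)] and [a - k], both of value
    [v (a - k)]. *)
Lemma conj_distance_ge g : conj_distances v K a g ->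
  forall k, K k -> v (a - k) <= g.
Proof.
move=> [b [[s sG sb] _] <-] k Kk; rewrite [v (a - b)]valBC.
have -> : b - a = s (a - k) - (a - k).
  by rewrite rmorphB sb (sG.2 k Kk) opprB addrA subrK.
by rewrite val_leD ?Defs.valN // (galois_val hens _ sG).
Qed.

Lemma conj_distances_finite :
  exists gs : seq (with_top G), forall g, conj_distances v K a g -> g \in gs.
Proof.
have [f fm] := exists_minimal K_field K_alg a KKS.
have [fmon fK fa _] := fm.
have [rs frs] := closed_field_poly_normal f.
exists [seq v (a - b) | b <- rs] => _ [b [[s sG sb] _] <-].
apply: map_f; have : root f b.
  have <- : map_poly s f = f.
    apply/polyP => i; rewrite coef_map; apply: sG.2.
    exact/(@in_subringP _ KS)/(polyOverP fK).
  by rewrite -sb fmorph_root.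
by rewrite frs (monicP fmon) scale1r root_prod_XsubC.
Qed.

Lemma distant_conj_distances_bound (gs : seq (with_top G)) : uniq gs ->
  (forall g, g \in gs -> conj_distances v K a g /\
     forall k, K k -> v (a - k) < g) ->
  (size gs <= logn (resid_char_exponent v) (degree LS a))%N.
Proof.
move=> gs_uniq gsP; have KL := base_sub_ramified.
have [f fm] := exists_minimal K_field K_alg a KL.
have [fmon fL fa _] := fm; rewrite (degree_minimal K_field K_alg KL fm).
have [X fX] := closed_field_poly_normal f.
rewrite (monicP fmon) scale1r in fX.
have X_uniq : uniq X.
  rewrite -separable_prod_XsubC -fX; have [g [_ gK ga _] gsep] := a_sep.
  apply: dvdp_separable gsep; have [|u ->] := minimal_dvd fm _ ga.
    by apply: polyOverS gK => k /set_mem Kk; apply/in_subringP/KL.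
  exact: dvdp_mull.
have memX x : (x \in X) = root f x by rewrite fX root_prod_XsubC.
have perm s : galois_group K s -> (forall x, subring_set LS x -> s x = x) ->
    perm_eq (map s X) X.
  move=> sG sL; have s_uniq : uniq (map s X).
    by rewrite map_inj_uniq //; exact: fmorph_inj.
  have sf : map_poly s f = f.
    apply/polyP => i; rewrite coef_map; apply: sL.
    exact/(@in_subringP _ LS)/(polyOverP fL).
  have s_sub : {subset map s X <= X}.
    move=> _ /mapP[x + ->]; rewrite !memX.
    by rewrite -{2}sf fmorph_root.
  have [|_ sX] := uniq_min_size s_uniq s_sub; first by rewrite size_map.
  exact: uniq_perm.
have -> : (size f).-1 = size X by rewrite fX size_prod_XsubC.
apply: (@step_values_bound F G v X a) => //.
- by rewrite memX.
(* Homogeneity: automorphisms fixing [L] act transitively on the roots of [f] and preserve [v]. *)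
- move=> b; rewrite memX => fb.
  have [s sG [sL sab]] := conjugate_extension K_closure KL fm fb.
  exists s => //; split; first exact: perm.
  by move=> x y; rewrite -rmorphB (galois_val hens _ sG).
- move=> g /gsP[[b [[s sG sb] /eqP ba] <-] sa].
  have [|t tG [ta tc]] := conjugate_close sG.
    by move=> k /sa; rewrite sb [v (b - a)]valBC.
  (* Closeness of [t] to the identity puts it in the ramification group, so it fixes [L] and
     permutes [X]. *)
  have tr : ramification_group v K t.
    split=> // x _ x0; case: (tc x) => [<-|//].
    by rewrite subrr val0 lt_Infty; apply/eqP.
  exists t; split=> //.
  + by apply: perm => // x [_ [_ xr]]; exact: xr.
  + by rewrite ta sb.
  + by move=> x y; rewrite rmorphB.
  + by rewrite ta sb valBC.
Qed.

End Purity.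

(** * Cardinality of the set of conjugate distances *)

Lemma card_le_seq (T : choiceType) (A : set T) (s : seq T) n :
  (forall x, A x -> x \in s) -> (size s <= n)%N -> A #<= `I_n.
Proof.
move=> As sn; have index_inj : {in A &, injective (index^~ s)}.
  move=> x y /set_mem/As xs /set_mem/As ys e.
  by rewrite -(nth_index x xs) e nth_index.
rewrite -(card_le_eql (inj_card_eq index_inj)); apply: subset_card_le.
by move=> _ [x /As xs <-] /=; rewrite (leq_trans _ sn) // index_mem.
Qed.

Theorem theorem1p4 (G : orderedZmodType) (Kbar : closedFieldType)
    (v : valuation Kbar G) (K : set Kbar) (a : Kbar) :
  algebraic_closure_of K ->
  henselian v K ->
  nontrivial_on v K ->
  (sep_closure K `\` K) a ->
  pure v K a ->
  ~ tame v K (adjoin K a) ->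
  let p := resid_char_exponent v in
  let L := adjoin K a `&` ramification_field v K in
  let max_is_conj_distance :=
    exists m, is_max (base_distances v K a) m /\ conj_distances v K a m in
  (max_is_conj_distance ->
     conj_distances v K a #<= `I_((logn p (degree L a)).+1)) /\
  (~ max_is_conj_distance ->
     conj_distances v K a #<= `I_(logn p (degree L a))).
Proof.
move=> K_closure hens _ [a_sep _] a_pure _ p L max_is_conj_distance.
have [gs gsP] := conj_distances_finite v a K_closure.
pose distant g := conj_distances v K a g /\ forall k, K k -> v (a - k) < g.
pose ds := [seq g <- undup gs | `[< distant g >]].
have ds_size : (size ds <= logn p (degree L a))%N.
  apply: (distant_conj_distances_bound K_closure hens a_sep a_pure).
    by rewrite filter_uniq ?undup_uniq.
  by move=> g; rewrite mem_filter => /andP[/asboolP].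
(* A conjugate distance that is not distant equals some [v (a - k)]; being an upper bound of the
   base distances, it is their maximum. *)
have dsP g : conj_distances v K a g ->
    g \in ds \/ is_max (base_distances v K a) g.
  move=> Sg; have gge := conj_distance_ge hens Sg.
  have [gd|ngd] := pselect (distant g).
    by left; rewrite mem_filter mem_undup gsP // andbT; apply/asboolP.
  right; have [k Kk kg] : exists2 k, K k & v (a - k) = g.
    apply: contrapT => nk; apply: ngd; split=> // k Kk.
    by rewrite lt_neqAle gge // andbT; apply/eqP => kg; apply: nk; exists k.
  by split=> [|_ [k' Kk' <-]]; [exists k|exact: gge].
split=> [[m [m_max _]]|nmax].
  (* The maximum is unique, so it adds just one value to [ds]. *)
  apply: (@card_le_seq _ _ (m :: ds)) => // g /dsP[gds|g_max].
    by rewrite in_cons gds orbT.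
  have -> : g = m; last exact: mem_head.
  by apply/eqP; rewrite eq_le (m_max.2 _ g_max.1) (g_max.2 _ m_max.1).
apply: (card_le_seq _ ds_size) => g Sg; case: (dsP g Sg) => // g_max.
by case: nmax; exists g.
Qed.
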